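(* Let $A$ be a ring with involution $*$, let $n\ge 1$, let $F$ be a field, and let $P=C\rtimes L\cong H_n(A)\rtimes \mathcal{U}_n(A)$ be the group defined in the context. For $1\le i\le n$ and a left admissible linear character $\lambda:A^+\to F^*$, let $V_{i,\lambda}$ be the $P$-module over $F$ defined in the context. (a) For every $1\le i\le n$ and every left admissible linear character $\lambda:A^+\to F^*$, the $P$-module $V_{i,\lambda}$ is irreducible, of dimension $|A|^{n-i}$ over $F$. (b) Let $D$ be any non-empty subset of $\{1,\dots,n\}$ and let $\lambda$ be a choice function that assigns to each $i\in D$ a left admissible linear character $\lambda_i:A^+\to F^*$. Then $$V(D,\lambda)=\bigotimes_{i\in D} V_{i,\lambda_i}$$ is a monomial irreducible $P$-module. (c) For any two such pairs $(D,\lambda)$ and $(D',\lambda')$, one has $V(D,\lambda)\cong V(D',\lambda')$ as $P$-modules if and only if $D=D'$ and $\lambda_i|_R=\lambda'_i|_R$ for all $i\in D$, where $R=\{r\in A\mid r^*=r\}$.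
   Context: $A$ is a ring with $1\neq 0$, not necessarily finite or commutative, with an involution $*$, i.e. an anti-automorphism of $A$ of order $\le 2$. For a square matrix $B$ over $A$, $(B^* )_{ij}=(B_{ji})^*$. $H_n(A)$ is the additive group of $n\times n$ matrices $S$ over $A$ with $S^*=S$, and $\mathcal{U}_n(A)$ is the group of upper triangular $n\times n$ matrices over $A$ with 1's on the diagonal; it acts on $H_n(A)$ by $Y\cdot S=YSY^*$. $V$ is a free right $A$-module with basis $u_1,\dots,u_n,v_1,\dots,v_n$, and $h:V\times V\to A$ is the skew-hermitian form (linear in the second variable, $h(v,u)=-h(u,v)^*$) with $h(u_i,u_j)=h(v_i,v_j)=0$, $h(u_i,v_j)=\delta_{ij}$, $h(v_i,u_j)=-\delta_{ij}$. $U$ is the subgroup of $\mathrm{GL}(V_A)$ preserving $h$. $M$ and $N$ are the $A$-spans of $u_1,\dots,u_n$ and of $v_1,\dots,v_n$. $C$ is the pointwise stabilizer of $M$ in $U$; its elements are those with matrix $\begin{pmatrix}1_n&S\\0&1_n\end{pmatrix}$, $S\in H_n(A)$, in the given basis. $L$ is the subgroup of $U$ of all elements with matrix $\begin{pmatrix}Y&0\\0&(Y^{-1})^*\end{pmatrix}$, $Y\in\mathcal{U}_n(A)$. Then $P=C\rtimes L\cong H_n(A)\rtimes\mathcal{U}_n(A)$. All modules are (possibly infinite dimensional) over the field $F$. A linear character $\lambda:A^+\to F^*$ is a group homomorphism from the additive group of $A$; it is left admissible if the kernel of the linear character $\lambda^\sharp:A^+\to F^*$, $\lambda^\sharp(\alpha)=\lambda(\alpha+\alpha^*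 )$, contains no left ideals of $A$ other than $(0)$. For $v\in N$, $L_v$ is the stabilizer of $v$ in $L$, and $\chi_{v,\lambda}:C\rtimes L_v\to F^*$ is the linear character $\chi_{v,\lambda}(g)=\lambda(h(gv,v))$. For $1\le i\le n$, $W_i$ is the 1-dimensional $C\rtimes L_{v_i}$-module over $F$ on which $C\rtimes L_{v_i}$ acts via $\chi_{v_i,\lambda}$, and $V_{i,\lambda}=\mathrm{ind}_{C\rtimes L_{v_i}}^{P}W_i$ (where $\mathrm{ind}_K^G W=FG\otimes_{FK}W$). A module is monomial if it is isomorphic to a module induced from a 1-dimensional module of a subgroup. Dimensions are cardinal numbers. *)

(* Defs.v *)
From HB Require Import structures.
From mathcomp Require Import all_boot all_algebra.
From mathcomp Require Import boolp classical_sets.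
From mathcomp Require Import freeg.

Set Implicit Arguments.
Unset Strict Implicit.
Unset Printing Implicit Defensive.

Import GRing.Theory.
Local Open Scope ring_scope.
Local Open Scope quotient_scope.
Local Open Scope classical_set_scope.

Section FreeLift.
Context (R : nzRingType) (K : choiceType) (V : lmodType R) (f : K -> V).

Lemma fglift_is_linear : linear (fglift f : {freeg K / R} -> V).
Proof.
have fD (x y : {freeg K / R}) : fglift f (x + y) = fglift f x + fglift f y.
  have fB := lift_is_additive f.
  have f0 : fglift f 0 = 0 by have := fB 0 0; rewrite !subr0 subrr.
  by rewrite -[y in LHS]opprK fB -[- y]sub0r fB f0 sub0r opprK.
have f0 : fglift f 0 = 0 by apply: (@addrI _ (fglift f 0)); rewrite -fD !addr0.
move=> a x y; rewrite fD; congr (_ + _).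
have fS (r : seq K) (F : K -> {freeg K / R}) :
    fglift f (\sum_(k <- r) F k) = \sum_(k <- r) fglift f (F k).
  exact: (big_morph (fglift f) fD f0).
rewrite -[X in _ = a *: fglift f X]freeg_sumE !fS scaler_sumr.
by apply: eq_bigr => k _; rewrite !liftU scalerA.
Qed.

HB.instance Definition _ :=
  GRing.isLinear.Build R {freeg K / R} V *:%R (fglift f) fglift_is_linear.

Lemma fglift_gen k : fglift f << k >> = f k.
Proof. by rewrite liftU scale1r. Qed.

End FreeLift.

Definition subspace (R : nzRingType) (V : lmodType R) (S : set V) : Prop :=
  S 0 /\ forall a u v, S u -> S v -> S (a *: u + v).

Definition lspan (R : nzRingType) (V : lmodType R) (B : set V) : set V :=
  [set v | forall S, subspace S -> B `<=` S -> S v].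

Lemma free_ind (R : nzRingType) (K : choiceType) (S : set {freeg K / R}) :
  subspace S -> (forall k, S << k >>) -> forall z, S z.
Proof.
move=> [S0 SD] Sk z; rewrite -(freeg_sumE z).
elim: (dom z) => [|k r IH]; first by rewrite big_nil.
rewrite big_cons -[<< _ *g k >>](_ : coeff k z *: << k >> = _); first exact: SD.
by apply/eqP/freeg_eqP => x; rewrite coeffZ !coeffU mul1r.
Qed.

Lemma subspace_eq (R : nzRingType) (U V : lmodType R) (f g : U -> V) :
  linear f -> linear g -> subspace [set u | f u = g u].
Proof.
move=> fl gl; split=> [|a u v /= fu fv]; last by rewrite fl gl fu fv.
have l0 (h : U -> V) : linear h -> h 0 = 0.
  by move=> hl; have := hl (-1) 0 0; rewrite scaler0 addr0 scaleN1r addNr.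
by rewrite /= !l0.
Qed.

Section Presented.
Context (F : fieldType) (X : choiceType) (rels : set {freeg X / F}).
Local Notation free := {freeg X / F}.

Lemma span_subspace : subspace (lspan rels).
Proof.
split=> [S [S0 _] _ //|a u v Su Sv S sS rS].
by apply: sS.2; [exact: Su|exact: Sv].
Qed.

Lemma spanB u v : lspan rels u -> lspan rels v -> lspan rels (u - v).
Proof.
move=> Su Sv; rewrite addrC -scaleN1r.
exact: span_subspace.2.
Qed.

Lemma spanD u v : lspan rels u -> lspan rels v -> lspan rels (u + v).
Proof. by rewrite -{2}[u]scale1r; exact: span_subspace.2. Qed.

Lemma spanZ a u : lspan rels u -> lspan rels (a *: u).
Proof.
by move=> Su; rewrite -[_ *: _]addr0; apply: span_subspace.2 => //;
  exact: span_subspace.1.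
Qed.

Definition pres_rel (x y : free) : bool := `[< lspan rels (x - y) >].

Lemma pres_relxx : reflexive pres_rel.
Proof. by move=> x; apply/asboolP; rewrite subrr; exact: span_subspace.1. Qed.
Lemma pres_relC : symmetric pres_rel.
Proof.
suff sw x y : pres_rel x y -> pres_rel y x.
  by move=> x y; apply/idP/idP; exact: sw.
move=> /asboolP xy; apply/asboolP; rewrite -opprB -sub0r.
by apply: spanB => //; exact: span_subspace.1.
Qed.
Lemma pres_relT : transitive pres_rel.
Proof.
move=> y x z /asboolP xy /asboolP yz; apply/asboolP.
by rewrite -[x](subrK y) -addrA; exact: spanD.
Qed.

Canonical pres_equiv := EquivRel pres_rel pres_relxx pres_relC pres_relT.
Canonical pres_equiv_direct := defaultEncModRel pres_rel.

(* the F-space with generators X and relations rels, i.e. the quotient of the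
   free F-space on X by the span of rels *)
Definition presented := {eq_quot pres_rel}.
HB.instance Definition _ := Choice.on presented.
HB.instance Definition _ := Quotient.on presented.
HB.instance Definition _ := EqQuotient.on presented.

Lemma pres_eqP (x y : free) :
  \pi_presented x = \pi_presented y <-> lspan rels (x - y).
Proof.
split; first by move/eqmodP => /asboolP.
by move=> xy; apply/eqmodP/asboolP.
Qed.

Definition pres_add := lift_op2 presented (fun x y : free => x + y).
Definition pres_opp := lift_op1 presented (fun x : free => - x).
Definition pres_scale (a : F) := lift_op1 presented (fun x : free => a *: x).

Lemma repr_pi (x : free) : lspan rels (repr (\pi_presented x) - x).
Proof. by apply/pres_eqP; rewrite reprK. Qed.


Lemma pi_add (x y : free) :
  pres_add (\pi_presented x) (\pi_presented y) = \pi_presented (x + y).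
Proof.
unlock pres_add; apply/pres_eqP; rewrite opprD addrACA.
by apply: spanD; exact: repr_pi.
Qed.
Lemma pi_opp (x : free) : pres_opp (\pi_presented x) = \pi_presented (- x).
Proof.
unlock pres_opp; apply/pres_eqP; rewrite -opprD -scaleN1r.
by apply: spanZ; exact: repr_pi.
Qed.
Lemma pi_scale a (x : free) :
  pres_scale a (\pi_presented x) = \pi_presented (a *: x).
Proof.
unlock pres_scale; apply/pres_eqP; rewrite -scalerBr.
by apply: spanZ; exact: repr_pi.
Qed.

Lemma pres_addA : associative pres_add.
Proof.
by elim/quotW=> x; elim/quotW=> y; elim/quotW=> z; rewrite !pi_add addrA.
Qed.
Lemma pres_addC : commutative pres_add.
Proof. by elim/quotW=> x; elim/quotW=> y; rewrite !pi_add addrC. Qed.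
Lemma pres_add0 : left_id (\pi_presented 0) pres_add.
Proof. by elim/quotW=> x; rewrite pi_add add0r. Qed.
Lemma pres_addN : left_inverse (\pi_presented 0) pres_opp pres_add.
Proof. by elim/quotW=> x; rewrite pi_opp pi_add addNr. Qed.
HB.instance Definition _ :=
  GRing.isZmodule.Build presented pres_addA pres_addC pres_add0 pres_addN.

Lemma pres_scaleA a b v : pres_scale a (pres_scale b v) = pres_scale (a * b) v.
Proof. by elim/quotW: v=> x; rewrite !pi_scale scalerA. Qed.
Lemma pres_scale1 : left_id 1 pres_scale.
Proof. by elim/quotW=> x; rewrite pi_scale scale1r. Qed.
Lemma pres_scaleDr : right_distributive pres_scale +%R.
Proof.
move=> a; elim/quotW=> x; elim/quotW=> y.
by rewrite [_ + _ in LHS]pi_add [RHS]/GRing.add /= !pi_scale pi_add scalerDr.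
Qed.
Lemma pres_scaleDl v : {morph pres_scale^~ v : a b / a + b}.
Proof.
move=> a b; elim/quotW: v=> x.
by rewrite [RHS]/GRing.add /= !pi_scale pi_add scalerDl.
Qed.
HB.instance Definition _ := GRing.Zmodule_isLmodule.Build F presented
  pres_scaleA pres_scale1 pres_scaleDr pres_scaleDl.

Lemma pi_presented_linear : linear (\pi_presented : free -> presented).
Proof.
move=> a x y; rewrite -pi_add -pi_scale //.
Qed.

Definition pres_pi (x : free) : presented := \pi_presented x.
HB.instance Definition _ :=
  GRing.isLinear.Build F free presented *:%R pres_pi pi_presented_linear.

Lemma pres_pi_rel x : rels x -> pres_pi x = 0.
Proof.
by move=> xr; rewrite -(linear0 pres_pi); apply/pres_eqP => S _; rewrite subr0; apply.
Qed.

Definition pres_gen (x : X) : presented := \pi_presented << x >>.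

Section Lift.
Context (V : lmodType F) (f : X -> V).

Definition pres_lift (z : presented) : V := fglift f (repr z).

Hypothesis f_rels : forall r, rels r -> fglift f r = 0.

Lemma pres_liftE (x : free) : pres_lift (\pi_presented x) = fglift f x.
Proof.
have sK : subspace [set z | fglift f z = 0].
  apply: (@subspace_eq _ _ _ (fglift f) (fun=> 0)).
    exact: fglift_is_linear.
  by move=> a u v; rewrite scaler0 addr0.
have /= := repr_pi x sK f_rels.
rewrite addrC -scaleN1r fglift_is_linear scaleN1r addrC => /eqP.
by rewrite subr_eq0 => /eqP.
Qed.

Lemma pres_lift_is_linear : linear pres_lift.
Proof.
move=> a; elim/quotW=> x; elim/quotW=> y.
by rewrite -pi_presented_linear !pres_liftE fglift_is_linear.
Qed.

Lemma pres_lift_gen x : pres_lift (pres_gen x) = f x.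
Proof. by rewrite pres_liftE fglift_gen. Qed.

End Lift.

Lemma pres_ind (S : set presented) :
  subspace S -> (forall x, S (pres_gen x)) -> forall z, S z.
Proof.
move=> [S0 SD] Sg; elim/quotW; apply: free_ind => //.
split=> [|a x y Sx Sy]; first exact: S0.
by have := SD a _ _ Sx Sy; rewrite -pi_presented_linear.
Qed.

End Presented.

Section SubgroupType.
Context (G : groupType) (K : groupClosed G).

Record subgroup_type := SubgroupElt { sgval :> G; sgvalP : sgval \in K }.

HB.instance Definition _ := [isSub for sgval].
HB.instance Definition _ := [Choice of subgroup_type by <:].

Lemma subgroup_group_closed : group_closed K.
Proof. by split=> [|x y Kx Ky]; [exact: gpred1|exact: gpredF]. Qed.

HB.instance Definition _ :=
  SubChoice_isSubGroup.Build G (mem K) subgroup_type subgroup_group_closed.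

End SubgroupType.

Section ProductSubgroup.
Context (G : groupType) (C L : groupClosed G).

Definition prodsg : {pred G} :=
  [pred g : G | `[< exists c l, [/\ c \in C, l \in L & g = (c * l)%g] >]].

Hypothesis nCL : forall l c, l \in L -> c \in C -> (l * c * l^-1)%g \in C.

Lemma prodsg1 : (1 : G)%g \in prodsg.
Proof.
apply/asboolP; exists 1%g, 1%g.
by split; [exact: gpred1|exact: gpred1|rewrite mulg1].
Qed.

Lemma prodsgM : mulg_closed prodsg.
Proof.
move=> _ _ /asboolP[c [l [Cc Ll ->]]] /asboolP[d [k [Cd Lk ->]]].
apply/asboolP; exists (c * (l * d * l^-1))%g, (l * k)%g; split.
- by apply: gpredM => //; exact: nCL.
- exact: gpredM.
- by rewrite !mulgA mulgVK.
Qed.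

Lemma prodsgV : invg_closed prodsg.
Proof.
move=> _ /asboolP[c [l [Cc Ll ->]]]; apply/asboolP.
exists (l^-1 * c^-1 * l^-1^-1)%g, (l^-1)%g; split.
- by apply: nCL; rewrite gpredV.
- by rewrite gpredV.
- by rewrite mulgVK invgM.
Qed.

End ProductSubgroup.

Record gmodule (G : groupType) (F : fieldType) := GModule {
  gspace :> lmodType F;
  gact : G -> gspace -> gspace;
  gact_linear : forall g, linear (gact g);
  gact1 : forall v, gact 1%g v = v;
  gactM : forall g k v, gact (g * k)%g v = gact g (gact k v) }.

Definition gmodule_iso (G : groupType) (F : fieldType) (V W : gmodule G F) :
    Prop :=
  exists f : V -> W,
    [/\ linear f, bijective f & forall g v, f (gact g v) = gact g (f v)].

Definition irreducible (G : groupType) (F : fieldType) (V : gmodule G F) :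
    Prop :=
  (exists v : V, v <> 0) /\
  forall S : set V, subspace S -> (forall g v, S v -> S (gact g v)) ->
    S = [set 0] \/ S = setT.

(* V has a basis indexed by I: every vector is, in exactly one way, a finite
   linear combination of the b i *)
Definition has_dim (F : fieldType) (V : lmodType F) (I : choiceType) : Prop :=
  exists b : I -> V, bijective (fglift b : {freeg I / F} -> V).

Section Character.
Context (G : groupType) (F : fieldType) (chi : G -> F).
Hypotheses (chi1 : chi 1%g = 1)
           (chiM : forall g k, chi (g * k)%g = chi g * chi k).

Definition char_act (g : G) (v : F^o) : F^o := chi g * v.

Lemma char_act_linear g : linear (char_act g).
Proof. by move=> a u v; rewrite /char_act mulrDr; congr (_ + _); rewrite mulrCA. Qed.
Lemma char_act1 v : char_act 1%g v = v.
Proof. by rewrite /char_act chi1 mul1r. Qed.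
Lemma char_actM g k v : char_act (g * k)%g v = char_act g (char_act k v).
Proof. by rewrite /char_act chiM mulrA. Qed.

Definition char_module : gmodule G F :=
  GModule char_act_linear char_act1 char_actM.

End Character.

Section Induced.
Context (G : groupType) (F : fieldType) (K : groupClosed G)
  (W : gmodule (subgroup_type K) F).

Local Notation FG := {freeg G / F}.

Definition galg_lmul (g : G) : FG -> FG := fglift (fun x : G => << (g * x)%g >>).
Definition galg_rmul (g : G) : FG -> FG := fglift (fun x : G => << (x * g)%g >>).

Local Notation gens := (FG * W)%type.
Local Notation free := {freeg (FG * W)%type / F}.

(* The relations defining FG (x)_{FK} W: F-bilinearity and K-balancedness,
   hence FK-balancedness *)
Variant ind_rels : set free :=
| ind_linl a x y w :
    ind_rels (<< (a *: x + y, w) : gens >> - a *: << (x, w) : gens >>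
              - << (y, w) : gens >>)
| ind_linr a x w w' :
    ind_rels (<< (x, a *: w + w') : gens >> - a *: << (x, w) : gens >>
              - << (x, w') : gens >>)
| ind_balanced x (k : subgroup_type K) w :
    ind_rels (<< (galg_rmul (sgval k) x, w) : gens >>
              - << (x, gact k w) : gens >>).

Definition ind_space := presented ind_rels.

Definition ind_tens (x : FG) (w : W) : ind_space := pres_gen ind_rels (x, w).

Definition ind_act (g : G) : ind_space -> ind_space :=
  pres_lift (fun p : gens => ind_tens (galg_lmul g p.1) p.2).

Lemma galg_lmul_linear g : linear (galg_lmul g).
Proof. exact: fglift_is_linear. Qed.
Lemma galg_rmul_linear g : linear (galg_rmul g).
Proof. exact: fglift_is_linear. Qed.

Lemma galg_lrmul g k x :
  galg_lmul g (galg_rmul k x) = galg_rmul k (galg_lmul g x).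
Proof.
move: x; apply: free_ind.
  apply: (@subspace_eq _ _ _ (galg_lmul g \o galg_rmul k)
            (galg_rmul k \o galg_lmul g)).
    by move=> a u v /=; rewrite galg_rmul_linear galg_lmul_linear.
  by move=> a u v /=; rewrite galg_lmul_linear galg_rmul_linear.
move=> x /=; rewrite /galg_lmul /galg_rmul !fglift_gen.
by rewrite mulgA.
Qed.

Lemma galg_lmul1 x : galg_lmul 1%g x = x.
Proof.
move: x; apply: free_ind.
  by apply: subspace_eq; [exact: galg_lmul_linear|].
by move=> x /=; rewrite /galg_lmul fglift_gen mul1g.
Qed.

Lemma galg_lmulM g k x : galg_lmul (g * k)%g x = galg_lmul g (galg_lmul k x).
Proof.
move: x; apply: free_ind.
  apply: (@subspace_eq _ _ _ _ (galg_lmul g \o galg_lmul k)).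
    exact: galg_lmul_linear.
  by move=> a u v /=; rewrite !galg_lmul_linear.
by move=> x /=; rewrite /galg_lmul !fglift_gen mulgA.
Qed.

Lemma ind_tensDl a x y w :
  ind_tens (a *: x + y) w = a *: ind_tens x w + ind_tens y w.
Proof.
have := pres_pi_rel (ind_linl a x y w); rewrite !linearB linearZ /=.
by move/eqP; rewrite subr_eq0 subr_eq [RHS]addrC => /eqP.
Qed.
Lemma ind_tensDr a x w w' :
  ind_tens x (a *: w + w') = a *: ind_tens x w + ind_tens x w'.
Proof.
have := pres_pi_rel (ind_linr a x w w'); rewrite !linearB linearZ /=.
by move/eqP; rewrite subr_eq0 subr_eq [RHS]addrC => /eqP.
Qed.
Lemma ind_tens_balanced x (k : subgroup_type K) w :
  ind_tens (galg_rmul (sgval k) x) w = ind_tens x (gact k w).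
Proof.
have := pres_pi_rel (ind_balanced x k w); rewrite !linearB /=.
by move/eqP; rewrite subr_eq0 => /eqP.
Qed.

Lemma ind_act_rels g r : ind_rels r ->
  fglift (fun p : gens => ind_tens (galg_lmul g p.1) p.2) r = 0.
Proof.
case=> [a x y w|a x w w'|x k w]; rewrite !linearB ?linearZ /= !fglift_gen /=.
- by rewrite galg_lmul_linear ind_tensDl -addrA scalerN -opprD subrr.
- by rewrite (ind_tensDr a _ w w') -addrA scalerN -opprD subrr.
- by rewrite galg_lrmul ind_tens_balanced subrr.
Qed.

Lemma ind_act_linear g : linear (ind_act g).
Proof. exact: pres_lift_is_linear (@ind_act_rels g). Qed.

Lemma ind_act_tens g x w : ind_act g (ind_tens x w) = ind_tens (galg_lmul g x) w.
Proof. exact: pres_lift_gen (@ind_act_rels g) _. Qed.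

Lemma ind_act1 v : ind_act 1%g v = v.
Proof.
move: v; apply: pres_ind; first by apply: subspace_eq; [exact: ind_act_linear|].
by move=> [x w] /=; rewrite ind_act_tens galg_lmul1.
Qed.

Lemma ind_actM g k v : ind_act (g * k)%g v = ind_act g (ind_act k v).
Proof.
move: v; apply: pres_ind.
  apply: (@subspace_eq _ _ _ _ (ind_act g \o ind_act k)).
    exact: ind_act_linear.
  by move=> a u v /=; rewrite !ind_act_linear.
by move=> [x w] /=; rewrite !ind_act_tens galg_lmulM.
Qed.

(* ind_K^G W = FG (x)_{FK} W *)
Definition induced : gmodule G F := GModule ind_act_linear ind_act1 ind_actM.

End Induced.

Definition monomial (G : groupType) (F : fieldType) (V : gmodule G F) : Prop :=
  exists (K : groupClosed G) (W : gmodule (subgroup_type K) F),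
    has_dim W unit /\ gmodule_iso V (induced W).

Section Tensor.
Context (G : groupType) (F : fieldType) (I : finType) (V : I -> gmodule G F).

Local Notation gens := (forall i, V i).
Local Notation free := {freeg (forall i, V i) / F}.

(* multilinearity: z i = a x i + y i, while x, y and z agree off i *)
Variant tensor_rels : set free :=
| tensor_multilinear i a (x y z : gens) :
    z i = a *: x i + y i ->
    (forall j, j != i -> x j = z j /\ y j = z j) ->
    tensor_rels (<< z : gens >> - a *: << x : gens >> - << y : gens >>).

Definition tensor_space := presented tensor_rels.

Definition tens (x : gens) : tensor_space := pres_gen tensor_rels x.

Definition tensor_act (g : G) : tensor_space -> tensor_space :=
  pres_lift (fun x : gens => tens (fun i => gact g (x i))).

Lemma tens_multilinear i a (x y z : gens) :
  z i = a *: x i + y i -> (forall j, j != i -> x j = z j /\ y j = z j) ->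
  tens z = a *: tens x + tens y.
Proof.
move=> zi zj.
have := pres_pi_rel (tensor_multilinear zi zj); rewrite !linearB linearZ /=.
by move/eqP; rewrite subr_eq0 subr_eq [RHS]addrC => /eqP.
Qed.

Lemma tensor_act_rels g r : tensor_rels r ->
  fglift (fun x : gens => tens (fun i => gact g (x i))) r = 0.
Proof.
case=> i a x y z zi zj; rewrite !linearB linearZ /= !fglift_gen.
rewrite (@tens_multilinear i a (fun i => gact g (x i)) (fun i => gact g (y i))).
- by rewrite -addrA -opprD subrr.
- by rewrite zi gact_linear.
- by move=> j /zj[-> ->].
Qed.

Lemma tensor_act_linear g : linear (tensor_act g).
Proof. exact: pres_lift_is_linear (@tensor_act_rels g). Qed.

Lemma tensor_act_tens g x : tensor_act g (tens x) = tens (fun i => gact g (x i)).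
Proof. exact: pres_lift_gen (@tensor_act_rels g) _. Qed.

Lemma tensor_act1 v : tensor_act 1%g v = v.
Proof.
move: v; apply: pres_ind.
  by apply: subspace_eq; [exact: tensor_act_linear|].
move=> x /=; rewrite tensor_act_tens; congr tens.
by apply: functional_extensionality_dep => i; rewrite gact1.
Qed.

Lemma tensor_actM g k v : tensor_act (g * k)%g v = tensor_act g (tensor_act k v).
Proof.
move: v; apply: pres_ind.
  apply: (@subspace_eq _ _ _ _ (tensor_act g \o tensor_act k)).
    exact: tensor_act_linear.
  by move=> a u v /=; rewrite !tensor_act_linear.
move=> x /=; rewrite !tensor_act_tens; congr tens.
by apply: functional_extensionality_dep => i; rewrite gactM.
Qed.

Definition tensor : gmodule G F :=
  GModule tensor_act_linear tensor_act1 tensor_actM.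

End Tensor.

Record involution (A : nzRingType) := Involution {
  invol :> A -> A;
  involD : {morph invol : a b / a + b};
  involM : forall a b, invol (a * b) = invol b * invol a;
  involK : involutive invol }.

Section GeneralLinear.
Context (A : nzRingType) (m : nat).

(* GL(A^m) for the right A-module A^m of column vectors; invmx is only available
   over commutative rings, so the inverse matrix is part of the data *)
Record GLmx := GLMx {
  glmx :> 'M[A]_m;
  glinv : 'M[A]_m;
  glmxV : glmx *m glinv = 1%:M;
  glVmx : glinv *m glmx = 1%:M }.

Lemma glmx_inj : injective glmx.
Proof.
case=> [B B' BB' B'B] [D D' DD' D'D] /= eqBD; case: D / eqBD DD' D'D => DD' D'D.
have eqV : B' = D' by rewrite -[D']mul1mx -B'B -mulmxA DD' mulmx1.
by case: D' / eqV DD' D'D => DD' D'D; congr GLMx; exact: Prop_irrelevance.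
Qed.

HB.instance Definition _ := gen_eqMixin GLmx.
HB.instance Definition _ := gen_choiceMixin GLmx.

Definition GLone := GLMx (mulmx1 (1%:M : 'M[A]_m)) (mulmx1 (1%:M : 'M[A]_m)).
Definition GLinv (g : GLmx) := GLMx (glVmx g) (glmxV g).

Lemma GLmul_subproof (g k : GLmx) :
  (g *m k) *m (glinv k *m glinv g) = 1%:M.
Proof. by rewrite mulmxA -(mulmxA g) glmxV mulmx1 glmxV. Qed.
Lemma GLmul_subproofV (g k : GLmx) :
  (glinv k *m glinv g) *m (g *m k) = 1%:M.
Proof. by rewrite mulmxA -(mulmxA (glinv k)) glVmx mulmx1 glVmx. Qed.
Definition GLmul (g k : GLmx) :=
  GLMx (GLmul_subproof g k) (GLmul_subproofV g k).

Lemma GLmulA : associative GLmul.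
Proof. by move=> g k l; apply: glmx_inj; exact: mulmxA. Qed.
Lemma GLmul1 : left_id GLone GLmul.
Proof. by move=> g; apply: glmx_inj; exact: mul1mx. Qed.
Lemma GLmulr1 : right_id GLone GLmul.
Proof. by move=> g; apply: glmx_inj; exact: mulmx1. Qed.
Lemma GLmulV : left_inverse GLone GLinv GLmul.
Proof. by move=> g; apply: glmx_inj; exact: glVmx. Qed.
Lemma GLmulrV : right_inverse GLone GLinv GLmul.
Proof. by move=> g; apply: glmx_inj; exact: glmxV. Qed.
HB.instance Definition _ :=
  isGroup.Build GLmx GLmulA GLmul1 GLmulr1 GLmulV GLmulrV.

Lemma glmxM (g k : GLmx) : (g * k)%g = glmx g *m glmx k :> 'M_m.
Proof. by []. Qed.
Lemma glmx1 : (1 : GLmx)%g = 1%:M :> 'M_m.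
Proof. by []. Qed.

End GeneralLinear.

Section Unitary.
Context (A : nzRingType) (star : involution A).

Definition mxstar (m p : nat) (B : 'M[A]_(m, p)) : 'M[A]_(p, m) :=
  \matrix_(i, j) star (B j i).

Lemma star0 : star 0 = 0.
Proof. by apply: (@addrI _ (star 0)); rewrite -involD !addr0. Qed.
Lemma starN a : star (- a) = - star a.
Proof. by apply: (@addrI _ (star a)); rewrite -involD !subrr star0. Qed.
Lemma star1 : star 1 = 1.
Proof. by rewrite -[LHS]mul1r -{1}(involK star 1) -involM mul1r involK. Qed.
Lemma star_sum I (r : seq I) (f : I -> A) :
  star (\sum_(i <- r) f i) = \sum_(i <- r) star (f i).
Proof. exact: (big_morph star (involD star) star0). Qed.

Lemma mxstarM m p q (B : 'M_(m, p)) (D : 'M_(p, q)) :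
  mxstar (B *m D) = mxstar D *m mxstar B.
Proof.
apply/matrixP=> i j; rewrite !mxE star_sum; apply: eq_bigr => k _.
by rewrite !mxE involM.
Qed.
Lemma mxstarD m p (B D : 'M_(m, p)) : mxstar (B + D) = mxstar B + mxstar D.
Proof. by apply/matrixP=> i j; rewrite !mxE involD. Qed.
Lemma mxstar0 m p : mxstar (0 : 'M_(m, p)) = 0.
Proof. by apply/matrixP=> i j; rewrite !mxE star0. Qed.
Lemma mxstar1 m : mxstar (1%:M : 'M_m) = 1%:M.
Proof.
by apply/matrixP=> i j; rewrite !mxE eq_sym; case: (i == j); rewrite ?star1 ?star0.
Qed.
Lemma mxstar_col m p q (B : 'M_(m, q)) (D : 'M_(p, q)) :
  mxstar (col_mx B D) = row_mx (mxstar B) (mxstar D).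
Proof.
apply/matrixP=> i j; rewrite !mxE; case: splitP => k _; by rewrite !mxE.
Qed.

Context (n : nat).

(* Vectors are the columns of coordinates in the basis u_1..u_n,v_1..v_n; the
   block matrix is the Gram matrix of h in this basis *)
Definition hform (x y : 'cV[A]_(n + n)) : A :=
  (mxstar x *m block_mx 0 1%:M (- 1%:M) 0 *m y) 0 0.

Definition Mspan : set 'cV[A]_(n + n) := [set x | exists a : 'cV_n, x = col_mx a 0].
Definition Nvec (b : 'cV[A]_n) : 'cV[A]_(n + n) := col_mx 0 b.

Local Notation GL := (GLmx A (n + n)).

Definition unitaryg : {pred GL} :=
  [pred g : GL | `[< forall x y, hform (g *m x) (g *m y) = hform x y >]].

Definition Csub : {pred GL} :=
  [pred g : GL | (g \in unitaryg) && `[< forall x, Mspan x -> g *m x = x >]].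

Definition unitriangular (Y : 'M[A]_n) : Prop :=
  is_trig_mx Y^T /\ forall i, Y i i = 1.

Definition Lsub : {pred GL} :=
  [pred g : GL | (g \in unitaryg) &&
    `[< exists Y Y' : 'M_n,
          [/\ unitriangular Y, Y *m Y' = 1%:M, Y' *m Y = 1%:M
            & g = block_mx Y 0 0 (mxstar Y') :> 'M_(n + n)] >]].

Definition Lstab (x : 'cV[A]_(n + n)) : {pred GL} :=
  [pred g : GL | (g \in Lsub) && (g *m x == x)].

Lemma unitaryg1 : (1 : GL)%g \in unitaryg.
Proof. by apply/asboolP => x y; rewrite !mul1mx. Qed.
Lemma unitarygM : mulg_closed unitaryg.
Proof.
move=> g k /asboolP gU /asboolP kU; apply/asboolP => x y.
by rewrite -!mulmxA gU kU.
Qed.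
Lemma unitarygV : invg_closed unitaryg.
Proof.
move=> g /asboolP gU; apply/asboolP => x y.
by rewrite -gU !mulmxA !glmxV !mul1mx.
Qed.
HB.instance Definition _ := isMulClosed.Build GL unitaryg unitarygM.
HB.instance Definition _ := isMul1Closed.Build GL unitaryg unitaryg1.
HB.instance Definition _ := isInvClosed.Build GL unitaryg unitarygV.

Lemma CsubP (g : GL) :
  reflect (g \in unitaryg /\ forall x, Mspan x -> g *m x = x) (g \in Csub).
Proof. by apply: (iffP andP) => -[gU]; [move/asboolP|move=> ?; split=> //; apply/asboolP]. Qed.

Lemma Csub1 : (1 : GL)%g \in Csub.
Proof. by apply/CsubP; split=> [|x _]; [exact: unitaryg1|rewrite mul1mx]. Qed.
Lemma CsubM : mulg_closed Csub.
Proof.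
move=> g k /CsubP[gU gM] /CsubP[kU kM]; apply/CsubP; split; first exact: unitarygM.
by move=> x Mx; rewrite -mulmxA kM ?gM.
Qed.
Lemma CsubV : invg_closed Csub.
Proof.
move=> g /CsubP[gU gM]; apply/CsubP; split; first exact: unitarygV.
by move=> x Mx; rewrite -{1}(gM x Mx) mulmxA glVmx mul1mx.
Qed.
HB.instance Definition _ := isMulClosed.Build GL Csub CsubM.
HB.instance Definition _ := isMul1Closed.Build GL Csub Csub1.
HB.instance Definition _ := isInvClosed.Build GL Csub CsubV.

Lemma trig_trP (Y : 'M[A]_n) :
  is_trig_mx Y^T <-> forall i j : 'I_n, (j < i)%N -> Y i j = 0.
Proof.
split=> [/is_trig_mxP YT i j ji|YT]; first by rewrite -(YT j i ji) mxE.
by apply/is_trig_mxP => i j ij; rewrite mxE YT.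
Qed.

Lemma unitriangular1 : unitriangular 1%:M.
Proof.
split; last by move=> i; rewrite mxE eqxx.
by apply/trig_trP => i j ji; rewrite mxE -val_eqE gtn_eqF.
Qed.

Lemma unitriangularM Y Z :
  unitriangular Y -> unitriangular Z -> unitriangular (Y *m Z).
Proof.
move=> [/trig_trP Yt Yd] [/trig_trP Zt Zd]; split.
  apply/trig_trP => i j ji; rewrite mxE big1 // => k _.
  have [ki|ik] := ltnP k i; first by rewrite Yt ?mul0r.
  by rewrite Zt ?mulr0 // (leq_trans ji).
move=> i; rewrite mxE (bigD1 i) //= Yd Zd mul1r big1 ?addr0 // => k ki.
have [lki|] := ltnP k i; first by rewrite Yt ?mul0r.
by rewrite leq_eqVlt eq_sym (negPf ki : (_ == _ :> nat) = false) /= => ik;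
   rewrite Zt ?mulr0.
Qed.

Lemma unitriangularV Y Y' :
  unitriangular Y -> Y *m Y' = 1%:M -> unitriangular Y'.
Proof.
move=> [/trig_trP Yt Yd] YY'.
have E m : forall i : 'I_n, (n - i <= m)%N ->
    forall j : 'I_n, (j <= i)%N -> Y' i j = (i == j)%:R.
  elim: m => [|m IHm] i.
    by rewrite leqn0 subn_eq0 leqNgt ltn_ord.
  move=> nim j ji; have := congr1 (fun M : 'M_n => M i j) YY'.
  rewrite !mxE (bigD1 i) //= Yd mul1r big1 ?addr0 ?mulrb // => k ki.
  have [lki|] := ltnP k i; first by rewrite Yt ?mul0r.
  rewrite leq_eqVlt eq_sym (negPf ki : (_ == _ :> nat) = false) /= => ik.
  rewrite IHm; last exact: leq_trans ji (ltnW ik).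
    rewrite -val_eqE gtn_eqF ?mulr0 //; exact: leq_ltn_trans ji ik.
  rewrite -ltnS; apply: leq_trans nim.
  by rewrite ltn_sub2l ?ltn_ord.
split; last by move=> i; rewrite (E n) ?leq_subr // eqxx.
apply/trig_trP => i j ji; rewrite (E n) ?leq_subr // 1?ltnW //.
by rewrite -val_eqE gtn_eqF.
Qed.

Lemma LsubP (g : GL) :
  reflect (g \in unitaryg /\ exists Y Y' : 'M_n,
          [/\ unitriangular Y, Y *m Y' = 1%:M, Y' *m Y = 1%:M
            & g = block_mx Y 0 0 (mxstar Y') :> 'M_(n + n)])
   (g \in Lsub).
Proof. by apply: (iffP andP) => -[gU]; [move/asboolP|move=> ?; split=> //; apply/asboolP]. Qed.

Lemma Lsub1 : (1 : GL)%g \in Lsub.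
Proof.
apply/LsubP; split; first exact: unitaryg1.
exists 1%:M, 1%:M; rewrite mulmx1 mxstar1 glmx1 -scalar_mx_block.
by split=> //; exact: unitriangular1.
Qed.
Lemma LsubM : mulg_closed Lsub.
Proof.
move=> g k /LsubP[gU [Y [Y' [uY YY' Y'Y gE]]]] /LsubP[kU [Z [Z' [uZ ZZ' Z'Z kE]]]].
apply/LsubP; split; first exact: unitarygM.
exists (Y *m Z), (Z' *m Y'); split.
- exact: unitriangularM.
- by rewrite mulmxA -(mulmxA Y) ZZ' mulmx1.
- by rewrite mulmxA -(mulmxA Z') Y'Y mulmx1.
- rewrite glmxM gE kE mulmx_block mxstarM.
  by rewrite !mul0mx !mulmx0 !addr0 !add0r.
Qed.
Lemma LsubV : invg_closed Lsub.
Proof.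
move=> g /LsubP[gU [Y [Y' [uY YY' Y'Y gE]]]].
apply/LsubP; split; first exact: unitarygV.
exists Y', Y; split=> //; first exact: unitriangularV uY YY'.
have gB : g *m block_mx Y' 0 0 (mxstar Y) = 1%:M.
  rewrite gE mulmx_block !mul0mx !mulmx0 !addr0 !add0r YY' -mxstarM YY'.
  by rewrite mxstar1 -scalar_mx_block.
by rewrite -[RHS]mul1mx -(glVmx g) -mulmxA gB mulmx1.
Qed.
HB.instance Definition _ := isMulClosed.Build GL Lsub LsubM.
HB.instance Definition _ := isMul1Closed.Build GL Lsub Lsub1.
HB.instance Definition _ := isInvClosed.Build GL Lsub LsubV.

Lemma LstabP x (g : GL) : reflect (g \in Lsub /\ g *m x = x) (g \in Lstab x).
Proof. by apply: (iffP andP) => -[gL /eqP]. Qed.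

Lemma Lstab1 x : (1 : GL)%g \in Lstab x.
Proof. by apply/LstabP; rewrite mul1mx; split=> //; exact: Lsub1. Qed.
Lemma LstabM x : mulg_closed (Lstab x).
Proof.
move=> g k /LstabP[gL gx] /LstabP[kL kx]; apply/LstabP.
by split; [exact: LsubM|rewrite -mulmxA kx gx].
Qed.
Lemma LstabV x : invg_closed (Lstab x).
Proof.
move=> g /LstabP[gL gx]; apply/LstabP; split; first exact: LsubV.
by rewrite -{1}gx mulmxA glVmx mul1mx.
Qed.
HB.instance Definition _ x := isMulClosed.Build GL (Lstab x) (@LstabM x).
HB.instance Definition _ x := isMul1Closed.Build GL (Lstab x) (Lstab1 x).
HB.instance Definition _ x := isInvClosed.Build GL (Lstab x) (@LstabV x).

Lemma Lsub_Mspan (g : GL) x : g \in Lsub -> Mspan x -> Mspan (g *m x).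
Proof.
move=> /LsubP[_ [Y [Y' [_ _ _ ->]]]] [a ->]; exists (Y *m a).
by rewrite mul_block_col !mulmx0 mul0mx !addr0.
Qed.

Lemma LC_norm (l c : GL) : l \in Lsub -> c \in Csub -> (l * c * l^-1)%g \in Csub.
Proof.
move=> Ll /CsubP[cU cM]; have /LsubP[lU _] := Ll; apply/CsubP; split.
  by rewrite gpredM ?gpredV // gpredM.
move=> x Mx; rewrite -!mulmxA cM.
  by rewrite mulmxA glmxV mul1mx.
by apply: Lsub_Mspan => //; exact: LsubV.
Qed.

Lemma LstabC_norm x (l c : GL) :
  l \in Lstab x -> c \in Csub -> (l * c * l^-1)%g \in Csub.
Proof. by move=> /LstabP[Ll _]; exact: LC_norm. Qed.

Definition Psub : {pred GL} := prodsg Csub Lsub.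
HB.instance Definition _ := isMulClosed.Build GL Psub (prodsgM LC_norm).
HB.instance Definition _ := isMul1Closed.Build GL Psub (prodsg1 Csub Lsub).
HB.instance Definition _ := isInvClosed.Build GL Psub (prodsgV LC_norm).

Definition CLstab x : {pred GL} := prodsg Csub (Lstab x).

Definition Pgroup : groupType := subgroup_type Psub.

Definition CLstabP x : {pred Pgroup} :=
  [pred g : Pgroup | sgval g \in CLstab x].

Lemma CLstabP1 x : (1 : Pgroup)%g \in CLstabP x.
Proof. exact: (prodsg1 Csub (Lstab x)). Qed.
Lemma CLstabPM x : mulg_closed (CLstabP x).
Proof. by move=> g k gL kL; exact: (prodsgM (@LstabC_norm x)). Qed.
Lemma CLstabPV x : invg_closed (CLstabP x).
Proof. by move=> g gL; exact: (prodsgV (@LstabC_norm x)). Qed.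
HB.instance Definition _ x := isMulClosed.Build Pgroup (CLstabP x) (@CLstabPM x).
HB.instance Definition _ x := isMul1Closed.Build Pgroup (CLstabP x) (CLstabP1 x).
HB.instance Definition _ x := isInvClosed.Build Pgroup (CLstabP x) (@CLstabPV x).

Lemma hformDl x y z : hform (x + y) z = hform x z + hform y z.
Proof. by rewrite /hform mxstarD !mulmxDl mxE. Qed.
Lemma hformDr x y z : hform x (y + z) = hform x y + hform x z.
Proof. by rewrite /hform mulmxDr mxE. Qed.
Lemma hformE (a b c d : 'cV_n) :
  hform (col_mx a b) (col_mx c d) = (mxstar a *m d - mxstar b *m c) 0 0.
Proof.
rewrite /hform mxstar_col mul_row_block mul_row_col !mulmx0 add0r addr0 mulmx1.
by rewrite mulmxN mulmx1 mulNmx addrC.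
Qed.
Lemma hformMM x y : Mspan x -> Mspan y -> hform x y = 0.
Proof. by move=> [a ->] [b ->]; rewrite hformE mulmx0 mxstar0 mul0mx subr0 mxE. Qed.
Lemma hformNN a b : hform (Nvec a) (Nvec b) = 0.
Proof. by rewrite hformE mulmx0 mxstar0 mul0mx subr0 mxE. Qed.

Lemma Mspan_orth x : (forall y, Mspan y -> hform x y = 0) -> Mspan x.
Proof.
rewrite -[x]vsubmxK; move: (usubmx x) (dsubmx x) => a b xM.
exists a; congr col_mx; apply/matrixP => i j; rewrite ord1 [RHS]mxE.
have /(_ (ex_intro _ (delta_mx i 0) erefl)) := xM (col_mx (delta_mx i 0) 0).
rewrite hformE mulmx0 sub0r !mxE (bigD1 i) //= !mxE !eqxx mulr1 big1 => [|k ki].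
  move/eqP; rewrite addr0 oppr_eq0 => /eqP bi0.
  by rewrite -(involK star (b i 0)) bi0 star0.
by rewrite !mxE (negPf ki) mulr0.
Qed.

Lemma MspanD x y : Mspan x -> Mspan y -> Mspan (x + y).
Proof. by move=> [a ->] [b ->]; exists (a + b); rewrite add_col_mx addr0. Qed.

Lemma Csub_Mspan (c : GL) x : c \in Csub -> Mspan (c *m x - x).
Proof.
move=> /CsubP[/asboolP cU cM]; apply: Mspan_orth => y My.
have hN : hform (- x) y = - hform x y.
  apply/eqP; rewrite -addr_eq0 -hformDl addNr.
  by rewrite /hform mxstar0 !mul0mx mxE.
by rewrite hformDl hN -{1}(cM y My) cU subrr.
Qed.

End Unitary.

Arguments CLstabP {A} star {n} x.

Record linchar (A : nzRingType) (F : fieldType) := LinChar {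
  lchar :> A -> F;
  lchar_neq0 : forall a, lchar a != 0;
  lcharD : forall a b, lchar (a + b) = lchar a * lchar b }.

Lemma lchar0 (A : nzRingType) (F : fieldType) (lam : linchar A F) : lam 0 = 1.
Proof.
by apply: (mulfI (lchar_neq0 lam 0)); rewrite -lcharD addr0 mulr1.
Qed.

Definition left_ideal (A : nzRingType) (I : set A) : Prop :=
  [/\ I 0, forall x y, I x -> I y -> I (x + y) & forall a x, I x -> I (a * x)].

Definition left_admissible (A : nzRingType) (star : involution A)
    (F : fieldType) (lam : linchar A F) : Prop :=
  forall I : set A, left_ideal I ->
    (forall a, I a -> lam (a + star a) = 1) -> I = [set 0].

Section Modules.
Context (A : nzRingType) (star : involution A) (n : nat) (F : fieldType).

Local Notation GL := (GLmx A (n + n)).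
Local Notation P := (Pgroup star n).
Local Notation h := (@hform A star n).

Section Chi.
Context (b : 'cV[A]_n) (lam : linchar A F).
Local Notation v := (Nvec b).

Definition chi (g : subgroup_type (CLstabP star v)) : F :=
  lam (h (glmx (sgval (sgval g)) *m v) v).

Lemma CLstab_Mspan (g : GL) : g \in CLstab star v ->
  Mspan (g *m v - v) /\ forall x, Mspan x -> Mspan (g *m x).
Proof.
move=> /asboolP[c [l [Cc /LstabP[Ll lv] ->]]]; split.
  by rewrite glmxM -mulmxA lv; exact: Csub_Mspan Cc.
move=> x Mx; have /CsubP[_ cM] := Cc; have Mlx := Lsub_Mspan Ll Mx.
by rewrite glmxM -mulmxA cM.
Qed.

Lemma chi1 : chi 1%g = 1.
Proof. by rewrite /chi mul1mx hformNN lchar0. Qed.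

Lemma chiM g k : chi (g * k)%g = chi g * chi k.
Proof.
rewrite /chi -lcharD; congr (lam _).
set g' := sgval (sgval g); set k' := sgval (sgval k).
have gS : g' \in CLstab star v by have := sgvalP g; rewrite inE.
have kS : k' \in CLstab star v by have := sgvalP k; rewrite inE.
have /asboolP gU : g' \in @unitaryg A star n.
  have /asboolP[c [l [Cc Ll ->]]] := gS.
  by rewrite unitarygM //; [case/CsubP: Cc|case/LstabP: Ll => /LsubP[]].
have [Mg gM] := CLstab_Mspan gS; have [Mk _] := CLstab_Mspan kS.
rewrite (_ : glmx _ = g' *m k') // -mulmxA.
move: Mk; rewrite -[k' *m v in RHS](subrK v) -[k' *m v in LHS](subrK v).
move: (k' *m v - v) => m Mm; rewrite mulmxDr !hformDl hformNN addr0 addrC.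
congr (_ + _); rewrite -[RHS]gU -[g' *m v in RHS](subrK v) hformDr.
by rewrite (hformMM star (gM _ Mm) Mg) add0r.
Qed.

Definition Vmodule : gmodule P F := induced (char_module chi1 chiM).

End Chi.

(* V_{i,lambda}; indices start at 0, so that i : 'I_n stands for i + 1 *)
Definition Vmod (lam : linchar A F) (i : 'I_n) : gmodule P F :=
  Vmodule (delta_mx i 0) lam.

Definition VD (D : {set 'I_n}) (lam : {i : 'I_n | i \in D} -> linchar A F) :
    gmodule P F :=
  tensor (fun i : {i | i \in D} => Vmod (lam i) (sval i)).

End Modules.

Arguments Vmod {A} star {n F} lam i.
Arguments VD {A} star {n F} D lam.

(* Main.v *)
Require Import Defs.
From HB Require Import structures.
From mathcomp Require Import boolp classical_sets freeg.
From mathcomp Require Import all_boot all_algebra.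

Set Implicit Arguments.
Unset Strict Implicit.
Unset Printing Implicit Defensive.

Import GRing.Theory.
Local Open Scope ring_scope.

(** Every module of the theorem has a basis that [P] permutes up to nonzero
    scalars.  For [V_{i,lambda}] the basis is indexed by the [P]-orbit of [v_i]
    modulo [M], that is by the columns [b] with [b_k = 0] for [k < i] and
    [b_i = 1]; the entries below [b_i] are free, whence the dimension.  The
    subgroup [C] is diagonal in this basis: the hermitian matrix [S] scales the
    vector at [b] by [lambda (b^* S b)].  So [V(D, lambda)] has a basis indexed
    by the tuples [(b_i)_{i in D}] of such columns, and [S] scales the vector
    at a tuple by the product of the [lambda_i (b_i^* S b_i)].

    Two facts about these tuples carry the proof.  First, [P] is transitive on
    them ([nact_columns]): any choice of the columns [b_i] is a choice of
    columns of a lower unitriangular matrix, and every such matrix gives the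
    action on [N] of an element of [L].  Secondly, the character of [C]
    attached to a tuple determines [D], the tuple, and the restrictions of the
    [lambda_i] to [R] ([tuple_character_inj]).  This goes by induction on [i]:
    for a matrix [S] supported on row and column [i], with vanishing entries
    before [i], the factors beyond [i] are [1] and those before [i] are already
    known to agree, so that the factor at [i] is isolated.  The diagonal matrix
    units then give [lambda_i] on [R], and left admissibility makes
    the off-diagonal ones give the remaining entries of [b_i].

    The rest is formal.  In a submodule, differences of characters of [C]
    eliminate the coordinates of a vector one by one, so a nonzero submodule
    contains a basis vector and, by transitivity, all of them
    ([monomial_irreducible]).  A transitive monomial basis exhibits the module
    as induced from the stabilizer of any index ([transitive_monomial]).
    An isomorphism carries a basis vector to an eigenvector of [C] with the
    same character, and this character occurs in the target's basis
    ([hom_coef]), which gives one half of (c); for the other half, the scalars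
    by which [P] acts are products of values of the [lambda_i] on [R]
    ([star_hcoef]), so that equal restrictions to [R] give the same action. *)

(** * Bases and their coordinates *)

Section LinearMap.
Context (R : nzRingType) (U V : lmodType R) (f : U -> V) (fl : linear f).

Lemma linear_at0 : f 0 = 0.
Proof. by have := fl (-1) 0 0; rewrite scaler0 addr0 scaleN1r addNr. Qed.

Lemma linear_atZ a u : f (a *: u) = a *: f u.
Proof. by rewrite -[a *: u]addr0 fl linear_at0 addr0. Qed.

End LinearMap.

Section Basis.
Context (F : fieldType) (X : choiceType) (V : lmodType F).

Definition basis (b : X -> V) : Prop :=
  bijective (fglift b : {freeg X / F} -> V).

Lemma coeff_linear (x : X) : linear (coeff x : {freeg X / F} -> F^o).
Proof. by move=> a u v; rewrite coeffD coeffZ. Qed.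

(** Spanning is asked for as an induction principle, the form in which spaces
    given by generators and relations provide it; the dual functionals give
    independence. *)
Lemma basisI (b : X -> V) (phi : X -> V -> F^o) :
  (forall x, linear (phi x)) ->
  (forall x y, phi x (b y) = (y == x)%:R) ->
  (forall S : set V, subspace S -> (forall x, S (b x)) -> forall v, S v) ->
  basis b.
Proof.
move=> phil phib span.
have phiE x z : phi x (fglift b z) = coeff x z.
  move: z; apply: free_ind => [|y].
    apply: (@subspace_eq _ _ F^o (phi x \o fglift b) (coeff x)) => [a u v|].
      by rewrite /= fglift_is_linear phil.
    exact: coeff_linear.
  by rewrite /= fglift_gen phib coeffU mul1r.
have surj v : exists z, fglift b z == v.
  move: v; apply: span.
    split; first by exists 0; rewrite linear0.
    move=> a _ _ [u /eqP <-] [v /eqP <-]; exists (a *: u + v).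
    by rewrite fglift_is_linear.
  by move=> x; exists << x >>; rewrite fglift_gen.
exists (fun v => xchoose (surj v)) => [z|v]; last exact/eqP/(xchooseP (surj v)).
apply/eqP/freeg_eqP => x; rewrite -!phiE; congr (phi x _).
exact/eqP/(xchooseP (surj (fglift b z))).
Qed.

Section BasisTheory.
Context (b : X -> V) (b_basis : basis b).

Lemma basis_ind (S : set V) :
  subspace S -> (forall x, S (b x)) -> forall v, S v.
Proof.
move=> [S0 SD] Sb v; have [c _ bK] := b_basis; rewrite -(bK v).
move: (c v); apply: free_ind => [|x]; last by rewrite /= fglift_gen.
split=> [|a x y Sx Sy /=]; first by rewrite /= linear0.
by rewrite fglift_is_linear; exact: SD.
Qed.

Lemma basis_coord : exists phi : X -> V -> F^o,
  [/\ forall x, linear (phi x),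
      forall x y, phi x (b y) = (y == x)%:R,
      forall v w, (forall x, phi x v = phi x w) -> v = w
    & forall v, exists r : seq X, forall x, x \notin r -> phi x v = 0].
Proof.
have [c cK bK] := b_basis; exists (fun x v => coeff x (c v)); split.
- move=> x a u v; rewrite -(coeff_linear x a); congr coeff.
  by apply: (can_inj cK); rewrite fglift_is_linear !bK.
- by move=> x y; rewrite -(fglift_gen b) cK coeffU mul1r.
- move=> v w vw; apply: (can_inj bK); apply/eqP/freeg_eqP => x.
  exact: vw.
- by move=> v; exists (dom (c v)) => x; exact: coeff_outdom.
Qed.

End BasisTheory.
End Basis.

Lemma basis_reindex (F : fieldType) (X Y : choiceType) (V : lmodType F)
    (b : X -> V) (f : Y -> X) : basis b -> bijective f -> basis (b \o f).
Proof.
move=> bB [g fK gK]; have [phi [phil phib _ _]] := basis_coord bB.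
apply: (@basisI _ _ _ _ (fun y => phi (f y))) => [y|y z|S sS Sb] //.
  by rewrite phib (inj_eq (can_inj fK)).
by apply: (basis_ind bB sS) => x; rewrite -(gK x); exact: Sb.
Qed.

(** * Modules with a monomial basis *)

(** The action of [G] on a basis up to scalars: [mcoef] is the multiplicative
    cocycle by which [g] rescales the basis vector at [x] on its way to the one
    at [mact g x]. *)
Record monomial_action (G : groupType) (F : fieldType) (X : choiceType) :=
  MonomialAction {
    mact : G -> X -> X;
    mcoef : G -> X -> F;
    mact1 : forall x, mact 1%g x = x;
    mactM : forall g k x, mact (g * k)%g x = mact g (mact k x);
    mcoef1 : forall x, mcoef 1%g x = 1;
    mcoefM : forall g k x, mcoef (g * k)%g x = mcoef g (mact k x) * mcoef k x }.

Section MonomialAction.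
Context (G : groupType) (F : fieldType) (X : choiceType).
Context (M : monomial_action G F X).
Implicit Types (V : gmodule G F) (g : G) (x : X).

Lemma mactK g : cancel (mact M g) (mact M g^-1%g).
Proof. by move=> x; rewrite -mactM mulVg mact1. Qed.

Lemma mcoef_neq0 g x : mcoef M g x != 0.
Proof.
apply/eqP => gx0; have := mcoefM M g^-1%g g x.
by rewrite mulVg mcoef1 gx0 mulr0 => /eqP; rewrite oner_eq0.
Qed.

Definition transitive_from x0 := forall x, exists g, mact M g x0 == x.

Definition pointwise_fixing g := forall x, mact M g x = x.

Definition monomial_basis V (b : X -> V) : Prop :=
  basis b /\ forall g x, gact g (b x) = mcoef M g x *: b (mact M g x).

Section Irreducible.
Context (V : gmodule G F) (b : X -> V) (bM : monomial_basis b).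

Lemma coord_fixing (phi : X -> V -> F^o) c x v :
  (forall x, linear (phi x)) -> (forall x y, phi x (b y) = (y == x)%:R) ->
  pointwise_fixing c -> phi x (gact c v) = mcoef M c x *: phi x v.
Proof.
move=> phil phib cX; have [bB ba] := bM.
move: v; apply: (basis_ind bB) => [|y].
  apply: (@subspace_eq _ _ F^o (phi x \o gact c)
           (fun v => mcoef M c x *: phi x v)) => a u v.
    by rewrite /= gact_linear phil.
  by rewrite phil scalerDr !scalerA mulrC.
rewrite /= ba cX (linear_atZ (phil x)) phib.
by have [->|_] := eqVneq y x; rewrite ?scaler0.
Qed.

(** Let [v] be a nonzero vector of a submodule and [x] in its support.  If [y]
    is another index in the support and the diagonal element [c] has different
    eigenvalues at [x] and [y], then [c v - (mcoef c y) v] still has [x], but no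
    longer [y], in its support.  Iteration leaves a multiple of [b x], and
    transitivity does the rest. *)
Lemma monomial_irreducible x0 : transitive_from x0 ->
  (forall x y, (forall c, pointwise_fixing c -> mcoef M c x = mcoef M c y) ->
     x = y) ->
  irreducible V.
Proof.
move=> tr sep; have [bB ba] := bM; have [phi [phil phib phiI phis]] := basis_coord bB.
have phi0 x : phi x 0 = 0 by exact: linear_at0.
split.
  exists (b x0) => b0; have := phib x0 x0; rewrite b0 phi0 eqxx => /esym/eqP.
  by rewrite oner_eq0.
move=> S [S0 SD] Sg; have SZ a v : S v -> S (a *: v).
  by move=> Sv; rewrite -[_ *: _]addr0; exact: SD.
have elim_dom r : forall v x, S v -> phi x v != 0 ->
    (forall z, z \notin x :: r -> phi z v = 0) -> S (b x).
  elim: r => [|y r IHr] v x Sv vx vr.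
    suff -> : b x = (phi x v)^-1 *: v by exact: SZ.
    apply: phiI => z; rewrite (linear_atZ (phil z)) phib.
    have [<-|xz] := eqVneq x z; first by rewrite /GRing.scale /= mulVf.
    by rewrite (vr z) ?scaler0 // inE eq_sym.
  have [xy|xy] := eqVneq x y.
    by apply: (IHr v) => // z zr; apply: vr; move: zr; rewrite !inE xy orbA orbb.
  have [c [cX cxy]] : exists c, pointwise_fixing c /\ mcoef M c x != mcoef M c y.
    apply: contrapT => nc; move/eqP: xy; apply; apply: sep => c cX.
    by apply/eqP/negPn/negP => cxy; apply: nc; exists c.
  pose w := - mcoef M c y *: v + gact c v.
  have wE z : phi z w = (mcoef M c z - mcoef M c y) * phi z v.
    by rewrite phil coord_fixing // mulrBl addrC -mulNr.
  apply: (IHr w); first by apply: SD => //; exact: Sg.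
    by rewrite wE mulf_neq0 // subr_eq0.
  move=> z zr; rewrite wE.
  have [->|zy] := eqVneq z y; first by rewrite subrr mul0r.
  by rewrite (vr z) ?mulr0 //; move: zr; rewrite !inE (negPf zy).
have [[v [Sv v0]]|S00] := pselect (exists v, S v /\ v <> 0); last first.
  left; apply/seteqP; split=> [v Sv|_ -> //]; apply: contrapT => v0.
  by apply: S00; exists v.
right; apply/seteqP; split=> // w _; have [x vx] : exists x, phi x v != 0.
  apply: contrapT => nx; apply: v0; apply: phiI => x; rewrite phi0.
  by apply/eqP/negPn/negP => vx; apply: nx; exists x.
have [r rP] := phis v; have Sbx : S (b x).
  apply: (elim_dom r v) => // z zr; apply: rP; apply: contra zr => zr.
  by rewrite inE zr orbT.
move: w; apply: (basis_ind bB) => // y; have [g /eqP gx] := tr x.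
have [k /eqP ky] := tr y; have := Sg (k * g^-1)%g _ Sbx.
rewrite ba mactM -gx mactK ky => /(SZ (mcoef M (k * g^-1)%g x)^-1).
by rewrite -gx scalerA mulVf ?scale1r // mcoef_neq0.
Qed.

End Irreducible.

End MonomialAction.

Lemma monomial_basis_iso (G : groupType) (F : fieldType) (X : choiceType)
    (M M' : monomial_action G F X) (V V' : gmodule G F)
    (b : X -> V) (b' : X -> V') :
  monomial_basis M b -> monomial_basis M' b' ->
  mact M =2 mact M' -> mcoef M =2 mcoef M' -> gmodule_iso V V'.
Proof.
move=> [bB ba] [bB' ba'] eqa eqc.
have [c cK bK] := bB; have [c' cK' bK'] := bB'.
have cl : linear c.
  by move=> a u v; apply: (can_inj cK); rewrite fglift_is_linear !bK.
pose f v := fglift b' (c v).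
have fl : linear f by move=> a u v; rewrite /f cl fglift_is_linear.
exists f; split=> //.
  by exists (fun v' => fglift b (c' v')) => [v|v']; rewrite /f ?cK' ?bK ?cK ?bK'.
move=> g; apply: (basis_ind bB) => [|x].
  by apply: (@subspace_eq _ _ _ (f \o gact g) (gact g \o f)) => a u v /=;
     rewrite ?gact_linear !fl ?gact_linear.
have fb y : f (b y) = b' y by rewrite /f -(fglift_gen b) cK fglift_gen.
by rewrite /= ba (linear_atZ fl) !fb ba' eqa eqc.
Qed.

(** Comparing a nonzero coordinate of the image of [b x] before and after the
    action of a diagonal element shows that the eigencharacter of [b x] occurs
    in the target. *)
Lemma hom_coef (G : groupType) (F : fieldType) (X X' : choiceType)
    (M : monomial_action G F X) (M' : monomial_action G F X')
    (V V' : gmodule G F) (b : X -> V) (b' : X' -> V') (f : V -> V') (x : X) :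
  monomial_basis M b -> monomial_basis M' b' -> linear f -> injective f ->
  (forall g v, f (gact g v) = gact g (f v)) ->
  exists x', forall c, pointwise_fixing M c -> pointwise_fixing M' c ->
    mcoef M c x = mcoef M' c x'.
Proof.
move=> bM bM' fl fI fG; have [bB ba] := bM; have [bB' ba'] := bM'.
have f0 := linear_at0 fl.
have [phi [phil phib _ _]] := basis_coord bB.
have [psi [psil psib psiI _]] := basis_coord bB'.
have phi0 y : phi y 0 = 0 by exact: linear_at0.
have psi0 y : psi y 0 = 0 by exact: linear_at0.
have [x' fx'] : exists x', psi x' (f (b x)) != 0.
  apply: contrapT => nx; have fb0 : f (b x) = f 0.
    apply: psiI => y; rewrite f0 psi0.
    by apply/eqP/negPn/negP => fy; apply: nx; exists y.
  have := phib x x; rewrite (fI _ _ fb0) phi0 eqxx => /esym/eqP.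
  by rewrite oner_eq0.
exists x' => c cX cX'; apply: (mulIf fx').
have := coord_fixing bM' x' (f (b x)) psil psib cX'.
rewrite -fG ba cX (linear_atZ fl) (linear_atZ (psil x')).
exact.
Qed.

(** * Induction from a stabilizer *)

Section InducedBasis.
Context (G : groupType) (F : fieldType) (X : choiceType).
Context (M : monomial_action G F X) (K : groupClosed G).
Context (chi : subgroup_type K -> F) (chi1 : chi 1%g = 1)
  (chiM : forall g k, chi (g * k)%g = chi g * chi k).
Context (x0 : X) (tr : transitive_from M x0).
Hypothesis stabK : forall g, (g \in K) = (mact M g x0 == x0).
Hypothesis chiE : forall k, chi k = mcoef M (sgval k) x0.

Local Notation W := (char_module chi1 chiM).

Let rep x : G := xchoose (tr x).

Let repP x : mact M (rep x) x0 = x.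
Proof. exact/eqP/(xchooseP (tr x)). Qed.

(** The scalar normalizes the vector so that it does not depend on the choice
    of the representative [rep x]; compare [ind_tens_gen]. *)
Definition ind_basis x : induced W :=
  ind_tens << rep x >> ((mcoef M (rep x) x0)^-1 : W).

Lemma ind_tensZr z (a : F) (w : W) :
  ind_tens z (a *: w) = a *: ind_tens z w :> induced W.
Proof. by apply: (@linear_atZ F W (induced W)) => c u v; exact: ind_tensDr. Qed.

Lemma ind_tens_gen g (w : W) :
  ind_tens << g >> w = (mcoef M g x0 * (w : F)) *: ind_basis (mact M g x0).
Proof.
set x := mact M g x0; set r := rep x.
have rgK : (r^-1 * g)%g \in K.
  by rewrite stabK mactM -/x -{1}(repP x) mactK.
pose k : subgroup_type K := SubgroupElt rgK.
have -> : << g >> = galg_rmul (sgval k) << r >> :> {freeg G / F}.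
  by rewrite /galg_rmul fglift_gen /= mulgA mulgV mul1g.
rewrite ind_tens_balanced /ind_basis -/r -ind_tensZr; congr ind_tens.
have kx0 : mact M (r^-1 * g)%g x0 = x0 by apply/eqP; rewrite -stabK.
have -> : mcoef M g x0 = mcoef M r x0 * mcoef M (r^-1 * g)%g x0.
  by have := mcoefM M r (r^-1 * g)%g x0; rewrite kx0 mulgA mulgV mul1g.
rewrite [LHS]/(chi k * w) chiE /= /GRing.scale /=.
by rewrite -(mulrA (mcoef M r x0)) [RHS]mulrC mulKf ?mcoef_neq0.
Qed.

(** The functional dual to the vector at [x] sends [g (x) w] to
    [mcoef g x0 * w] if [g] maps [x0] to [x], and to [0] otherwise; it is
    balanced by the cocycle identity. *)
Lemma ind_basis_monomial : monomial_basis M ind_basis.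
Proof.
split; last first.
  move=> g x; rewrite /= /ind_basis ind_act_tens /galg_lmul fglift_gen.
  by rewrite ind_tens_gen mcoefM mactM repP mulfK // mcoef_neq0.
pose pre x (g : G) : F^o := (mact M g x0 == x)%:R * mcoef M g x0.
pose phi0 x (p : {freeg G / F} * W) : F^o := fglift (pre x) p.1 * (p.2 : F).
have phi_rels x r : ind_rels r -> fglift (phi0 x) r = 0.
  case=> [a u v w|a u w w'|u k w]; rewrite !linearB ?linearZ /= !fglift_gen /phi0 /=.
  - rewrite fglift_is_linear mulrDl -addrA scalerN -opprD; apply/eqP.
    by rewrite subr_eq0 -scalerAl.
  - rewrite mulrDr -addrA scalerN -opprD; apply/eqP; rewrite subr_eq0.
    by rewrite /GRing.scale /= mulrCA.
  - apply/eqP; rewrite subr_eq0 /char_act mulrA; apply/eqP.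
    congr (_ * _); move: u; apply: free_ind => [|g].
      apply: (@subspace_eq _ _ F^o (fglift (pre x) \o galg_rmul (sgval k))
               (fun u => fglift (pre x) u * chi k)) => a u v.
        by rewrite /= galg_rmul_linear fglift_is_linear.
      by rewrite fglift_is_linear mulrDl -scalerAl.
    rewrite /= /galg_rmul !fglift_gen /pre mactM mcoefM chiE.
    have /eqP -> : mact M (sgval k) x0 == x0 by rewrite -stabK sgvalP.
    by rewrite mulrA.
apply: (@basisI _ _ _ _ (fun x => pres_lift (phi0 x))) => [x|x y|S sS Sb].
- exact: pres_lift_is_linear (@phi_rels x).
- rewrite /ind_basis /ind_tens (pres_lift_gen (@phi_rels x)) /phi0 /= fglift_gen.
  by rewrite /pre repP -mulrA mulfV ?mulr1 // mcoef_neq0.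
apply: pres_ind => // -[z w]; rewrite -/(ind_tens z w).
have [S0 SD] := sS.
have lt : linear (fun z => ind_tens z w : induced W).
  by move=> a u v; exact: ind_tensDl.
move: z; apply: free_ind => [|g].
  split=> [|a u v Su Sv]; first by rewrite /= (linear_at0 lt).
  by rewrite /= lt; exact: SD.
by rewrite /= ind_tens_gen -[_ *: _]addr0; exact: SD.
Qed.

End InducedBasis.

(** A transitive monomial basis identifies the module with the one induced from
    the stabilizer of [x0], since both have monomial bases for the same action. *)
Section Stabilizer.
Context (G : groupType) (F : fieldType) (X : choiceType).
Context (M : monomial_action G F X) (x0 : X).

Definition mstab : {pred G} := [pred g : G | mact M g x0 == x0].

Lemma mstab1 : (1 : G)%g \in mstab.
Proof. by rewrite inE mact1. Qed.
Lemma mstabM : mulg_closed mstab.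
Proof. by move=> g k; rewrite !inE mactM => /eqP gx /eqP ->; exact/eqP. Qed.
Lemma mstabV : invg_closed mstab.
Proof. by move=> g; rewrite !inE => /eqP gx; rewrite -{1}gx mactK. Qed.
HB.instance Definition _ := isMulClosed.Build G mstab mstabM.
HB.instance Definition _ := isMul1Closed.Build G mstab mstab1.
HB.instance Definition _ := isInvClosed.Build G mstab mstabV.

Definition stab_char (k : subgroup_type mstab) : F := mcoef M (sgval k) x0.

Lemma stab_char1 : stab_char 1%g = 1.
Proof. exact: mcoef1. Qed.
Lemma stab_charM g k : stab_char (g * k)%g = stab_char g * stab_char k.
Proof.
rewrite /stab_char mcoefM; congr (mcoef M _ _ * _).
by apply/eqP; have := sgvalP k; rewrite inE.
Qed.

Lemma transitive_monomial (V : gmodule G F) (b : X -> V) :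
  monomial_basis M b -> transitive_from M x0 -> monomial V.
Proof.
move=> bM tr; exists (mstab : groupClosed G).
exists (char_module stab_char1 stab_charM); split.
  exists (fun _ : unit => (1 : F^o)).
  apply: (@basisI F unit F^o _ (fun _ v => v)) => [//|_ [] //|S [S0 SD] S1 v].
  by rewrite -[v]mulr1 -[_ * _]addr0; exact: SD (S1 tt) S0.
exact: (monomial_basis_iso bM (ind_basis_monomial _ _ tr _ _)).
Qed.

End Stabilizer.

(** * Tensor products of monomial modules *)

Section TensorBasis.
Context (G : groupType) (F : fieldType) (I : finType) (V : I -> gmodule G F).
Context (X : I -> choiceType) (M : forall i, monomial_action G F (X i)).

Local Notation XX := (forall i, X i).

Definition prod_mact g (x : XX) : XX := fun i => mact (M i) g (x i).
Definition prod_mcoef g (x : XX) : F := \prod_i mcoef (M i) g (x i).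

Lemma prod_mact1 x : prod_mact 1%g x = x.
Proof. by apply: functional_extensionality_dep => i; exact: mact1. Qed.
Lemma prod_mactM g k x : prod_mact (g * k)%g x = prod_mact g (prod_mact k x).
Proof. by apply: functional_extensionality_dep => i; exact: mactM. Qed.
Lemma prod_mcoef1 x : prod_mcoef 1%g x = 1.
Proof. by apply: big1 => i _; exact: mcoef1. Qed.
Lemma prod_mcoefM g k x :
  prod_mcoef (g * k)%g x = prod_mcoef g (prod_mact k x) * prod_mcoef k x.
Proof. by rewrite -big_split; apply: eq_bigr => i _; exact: mcoefM. Qed.

Definition prod_monomial : monomial_action G F XX :=
  MonomialAction prod_mact1 prod_mactM prod_mcoef1 prod_mcoefM.

Context (b : forall i, X i -> V i) (bM : forall i, monomial_basis (M i) (@b i)).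

Definition tensor_basis (x : XX) : tensor V := tens (fun i => b (x i)).

Lemma tens_dfwith_linear (v : forall i, V i) i :
  linear (fun u : V i => tens (dfwith v u) : tensor V).
Proof.
move=> a u w; apply: (@tens_multilinear _ _ _ _ i).
  by rewrite !dfwith_in.
by move=> j ji; rewrite !dfwith_out // eq_sym.
Qed.

Lemma dfwith_id (v : forall i, V i) i : dfwith v (v i) = v.
Proof.
apply: functional_extensionality_dep => j.
have [<-|ij] := eqVneq i j; first by rewrite dfwith_in.
by rewrite dfwith_out.
Qed.

(** Pure tensors are reached from tensors of basis vectors by freeing one
    factor at a time: the tensor is linear in each of its factors. *)
Lemma tensor_basis_span (S : set (tensor V)) :
  subspace S -> (forall x, S (tensor_basis x)) -> forall v, S v.
Proof.
move=> sS Sb; have [S0 SD] := sS; apply: pres_ind => // v; rewrite -/(tens v).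
have ext (r : seq I) : forall w : forall i, V i,
    (forall i, i \notin r -> exists x, w i = b x) -> S (tens w).
  elim: r => [|i r IHr] w wr.
    pose x i := projT1 (cid (wr i isT)).
    suff -> : w = fun i => b (x i) by exact: Sb.
    by apply: functional_extensionality_dep => i; exact: projT2 (cid (wr i isT)).
  have lt := tens_dfwith_linear w (i := i).
  rewrite -(dfwith_id w i); move: (w i); apply: (basis_ind (bM i).1).
    split=> [|a u u' Su Su']; first by rewrite /= (linear_at0 lt).
    by rewrite /= lt; exact: SD.
  move=> x /=; apply: IHr => j jr; have [ij|ij] := eqVneq i j.
    by case: j / ij jr => _; exists x; rewrite dfwith_in.
  by rewrite dfwith_out //; apply: wr; rewrite inE negb_or eq_sym ij.
by apply: (ext (enum I)) => i; rewrite mem_enum.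
Qed.

(** The dual functionals are the products of those of the factors. *)
Lemma tensor_basis_monomial : monomial_basis prod_monomial tensor_basis.
Proof.
have [phi phiP] : {phi : forall i, X i -> V i -> F^o & forall i,
    (forall x, linear (phi i x)) /\
    (forall x y, phi i x (b y) = (y == x)%:R)}.
  pose e i := cid (basis_coord (bM i).1).
  by exists (fun i => projT1 (e i)) => i; have [] := projT2 (e i).
pose Phi (x : XX) (v : forall i, V i) : F^o := \prod_i phi i (x i) (v i).
have Phi_rels x r : tensor_rels r -> fglift (Phi x) r = 0.
  case=> i a u v w wi wj; rewrite !linearB linearZ /= !fglift_gen.
  (* The three families in the relation differ at the factor [i] only. *)
  have PhiE (t : forall j, V j) : (forall j, j != i -> t j = w j) ->
      Phi x t = phi i (x i) (t i) * \prod_(j | j != i) phi j (x j) (w j).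
    move=> tw; rewrite /Phi (bigD1 i) //=; congr (_ * _).
    by apply: eq_bigr => j ji; rewrite tw.
  rewrite (PhiE w) // (PhiE u) => [|j /wj[]//]; rewrite (PhiE v) => [|j /wj[]//].
  by rewrite wi (phiP i).1 mulrDl -scalerAl -addrA -opprD subrr.
split.
  apply: (@basisI _ _ _ _ (fun x => pres_lift (Phi x))) => [x|x y|S sS Sb].
  - exact: pres_lift_is_linear (@Phi_rels x).
  - rewrite /tensor_basis /tens (pres_lift_gen (@Phi_rels x)) /Phi.
    have [<-|xy] := eqVneq y x.
      by apply: big1 => i _; rewrite (phiP i).2 eqxx.
    have [i xyi] : exists i, y i != x i.
      apply: contrapT => nx; move/eqP: xy; apply.
      apply: functional_extensionality_dep => i.
      by apply/eqP/negPn/negP => xyi; apply: nx; exists i.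
    by rewrite (bigD1 i) //= (phiP i).2 (negPf xyi) mul0r.
  exact: tensor_basis_span.
move=> g x; rewrite /= tensor_act_tens /tensor_basis.
pose y : forall i, V i := fun i => b (prod_mact g x i).
(* The scalars of the factors come out of the tensor one at a time. *)
have scale (r : seq I) : uniq r ->
    tens (fun i => if i \in r then mcoef (M i) g (x i) *: y i else y i) =
    (\prod_(i <- r) mcoef (M i) g (x i)) *: (tens y : tensor V).
  elim: r => [_|i r IHr /= /andP[ir ur]].
    by rewrite big_nil scale1r; congr tens.
  rewrite big_cons -scalerA -IHr //.
  set w := fun j => if j \in r then _ else _.
  have -> : tens w = tens (dfwith w (y i)) :> tensor V.
    rewrite -[in LHS](dfwith_id w i); congr (tens (dfwith _ _)).
    by rewrite /w (negPf ir).
  rewrite -(linear_atZ (tens_dfwith_linear w (i := i))); congr tens.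
  apply: functional_extensionality_dep => j; have [<-|ij] := eqVneq i j.
    by rewrite dfwith_in inE eqxx.
  by rewrite dfwith_out // inE eq_sym (negPf ij).
have := scale (index_enum I) (index_enum_uniq I); rewrite -[RHS]/(_ *: tens y) => <-.
congr tens; apply: functional_extensionality_dep => i.
by rewrite mem_index_enum (bM i).2.
Qed.

End TensorBasis.

(** * The action of P on N modulo M *)

Section UnitaryAction.
Context (A : nzRingType) (star : involution A) (n : nat).
Local Notation P := (Pgroup star n).
Local Notation h := (@hform A star n).
Local Notation mx g := (glmx (sgval g)).
Implicit Types (g k : P) (b : 'cV[A]_n).

Lemma mxstarK p q : cancel (@mxstar A star p q) (@mxstar A star q p).
Proof. by move=> B; apply/matrixP => i j; rewrite !mxE involK. Qed.

Lemma mxstarE p q (B : 'M[A]_(p, q)) i j : mxstar star B i j = star (B j i).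
Proof. exact: mxE. Qed.

Lemma mxstarB p q (B D : 'M[A]_(p, q)) :
  mxstar star (B - D) = mxstar star B - mxstar star D.
Proof. by apply/matrixP => i j; rewrite !mxE involD starN. Qed.

Lemma hform_star x y : star (h x y) = - h y x.
Proof.
rewrite -[x]vsubmxK -[y]vsubmxK !hformE.
by rewrite -mxstarE mxstarB !mxstarM !mxstarK -opprB mxE.
Qed.

(** [P] preserves [M], hence acts on the quotient by [M], whose elements are
    represented by their coordinates on [N]. *)
Definition nact g b : 'cV[A]_n := dsubmx (mx g *m Nvec b).

Lemma nact_split g b :
  exists2 m, Mspan m & mx g *m Nvec b = Nvec (nact g b) + m.
Proof.
exists (col_mx (usubmx (mx g *m Nvec b)) 0); first by eexists.
by rewrite add_col_mx addr0 add0r vsubmxK.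
Qed.

Lemma PgroupP g : exists c l,
  [/\ c \in @Csub A star n, l \in @Lsub A star n & sgval g = (c * l)%g].
Proof. exact/asboolP/(sgvalP g). Qed.

Lemma P_unitary g x y : h (mx g *m x) (mx g *m y) = h x y.
Proof.
have [c [l [/CsubP[cU _] /LsubP[lU _] ->]]] := PgroupP g.
by have /asboolP := unitarygM cU lU; exact.
Qed.

Lemma P_Mspan g x : Mspan x -> Mspan (mx g *m x).
Proof.
move=> Mx; have [c [l [/CsubP[_ cM] Ll ->]]] := PgroupP g.
have lM := Lsub_Mspan Ll Mx.
by rewrite glmxM -mulmxA cM.
Qed.

Lemma dsub_Mspan (x : 'cV[A]_(n + n)) : Mspan x -> dsubmx x = 0.
Proof. by move=> [a ->]; rewrite col_mxKd. Qed.

Lemma dsub_Nvec b : dsubmx (Nvec b) = b.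
Proof. exact: col_mxKd. Qed.

Lemma nact1 b : nact 1%g b = b.
Proof. by rewrite /nact mul1mx dsub_Nvec. Qed.

Lemma nactM g k b : nact (g * k)%g b = nact g (nact k b).
Proof.
have [m Mm km] := nact_split k b.
rewrite {1}/nact (_ : glmx _ = mx g *m mx k) // -mulmxA km mulmxDr linearD /=.
by rewrite (dsub_Mspan (P_Mspan g Mm)) addr0.
Qed.

(** The exponent by which [g] scales the basis vector at [b].  On the
    stabilizer of [b] it is the exponent [h (g v, v)] of the character [chi];
    the second argument [nact g b] makes it an additive cocycle on [P]. *)
Definition hcoef g b : A := h (mx g *m Nvec b) (Nvec (nact g b)).

Lemma hcoef1 b : hcoef 1%g b = 0.
Proof. by rewrite /hcoef mul1mx hformNN. Qed.

(** Write [k b = b' + m] and [g b' = b'' + m'] with [m] and [m'] in [M].  As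
    [g m] and [m'] are orthogonal, [h (g m, b'') = h (g m, g b') = h (m, b')],
    which is [hcoef k b]. *)
Lemma hcoefM g k b : hcoef (g * k)%g b = hcoef g (nact k b) + hcoef k b.
Proof.
have [m Mm km] := nact_split k b.
have [m' Mm' gm'] := nact_split g (nact k b).
rewrite {1}/hcoef nactM (_ : glmx _ = mx g *m mx k) // -mulmxA km mulmxDr hformDl.
congr (_ + _); transitivity (h (mx g *m m) (mx g *m Nvec (nact k b))).
  by rewrite gm' hformDr (hformMM star (P_Mspan g Mm) Mm') addr0.
by rewrite P_unitary /hcoef km hformDl hformNN add0r.
Qed.

(** With [g b = b' + m], isotropy of [g b] says [h (m, b') = - h (b', m)], and
    the form is skew-hermitian. *)
Lemma star_hcoef g b : star (hcoef g b) = hcoef g b.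
Proof.
have [m Mm gm] := nact_split g b; have mm0 := hformMM star Mm Mm.
have := P_unitary g (Nvec b) (Nvec b).
rewrite /hcoef gm hformDr !hformDl !hformNN mm0 !add0r addr0 hform_star.
by move/eqP; rewrite addr_eq0 => /eqP ->.
Qed.

(** * Elements of C and of L *)

Definition herm b (S : 'M[A]_n) : A := (mxstar star b *m S *m b) 0 0.

Section CElement.
Context (S : 'M[A]_n) (S_herm : mxstar star S = S).

Let upper_subproof (T : 'M[A]_n) :
  block_mx 1%:M T 0 1%:M *m block_mx 1%:M (- T) 0 1%:M = 1%:M :> 'M_(n + n).
Proof.
by rewrite mulmx_block !mul1mx !mulmx1 !mul0mx !mulmx0 !addr0 add0r addNr
  -scalar_mx_block.
Qed.

Let upper_subproofV :
  block_mx 1%:M (- S) 0 1%:M *m block_mx 1%:M S 0 1%:M = 1%:M :> 'M_(n + n).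
Proof. by rewrite -{2}[S]opprK; exact: upper_subproof. Qed.

Definition Cmx : GLmx A (n + n) := GLMx (upper_subproof S) upper_subproofV.

Lemma Cmx_C : Cmx \in @Csub A star n.
Proof.
apply/CsubP; split; last first.
  by move=> _ [a ->]; rewrite mul_block_col !mulmx0 mul0mx mul1mx !addr0.
apply/asboolP => x y; rewrite -[x]vsubmxK -[y]vsubmxK.
rewrite !mul_block_col !mul1mx !mul0mx !add0r !hformE; congr (fun M : 'M_1 => M 0 0).
rewrite !mxstarD !mxstarM S_herm !(mulmxDl, mulmxDr) !mulmxA opprD.
by rewrite addrACA subrr addr0.
Qed.

Lemma Cmx_P : Cmx \in @Psub A star n.
Proof.
by apply/asboolP; exists Cmx, 1%g; rewrite mulg1 Cmx_C Lsub1.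
Qed.

Definition Cgroup : P := SubgroupElt Cmx_P.

Lemma Cgroup_Nvec b : mx Cgroup *m Nvec b = col_mx (S *m b) b.
Proof. by rewrite mul_block_col mulmx0 mul0mx mul1mx !add0r. Qed.

Lemma nact_Cgroup b : nact Cgroup b = b.
Proof. by rewrite /nact Cgroup_Nvec col_mxKd. Qed.

Lemma hcoef_Cgroup b : hcoef Cgroup b = herm b S.
Proof.
rewrite /hcoef nact_Cgroup Cgroup_Nvec hformE mulmx0 subr0 mxstarM.
by rewrite S_herm.
Qed.

End CElement.

(** [1 - Y] is nilpotent, so the geometric series gives a right inverse.  This
    right inverse is unitriangular and so has a right inverse in turn, which
    must be [Y]. *)
Lemma unitriangular_inv (Y : 'M[A]_n) : unitriangular Y ->
  exists2 Y' : 'M_n, Y *m Y' = 1%:M & Y' *m Y = 1%:M.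
Proof.
have right_inv (T : 'M[A]_n) : unitriangular T -> exists T' : 'M_n, T *m T' = 1%:M.
  move=> [/trig_trP Tt Td]; pose N : 'M[A]_n := 1%:M - T.
  have Npow m : forall i j : 'I_n, (j < i + m)%N -> (N ^+ m) i j = 0.
    elim: m => [|m IHm] i j; rewrite ?addn0 => ji.
      by rewrite expr0 mxE -val_eqE gtn_eqF.
    rewrite exprS mxE big1 // => l _; have [li|il] := leqP l i.
      rewrite [N i l]mxE [X in X + _]mxE [X in _ + X]mxE.
      have [->|il] := eqVneq i l; first by rewrite Td subrr mul0r.
      rewrite Tt ?subr0 ?mul0r // ltn_neqAle li andbT.
      by rewrite eq_sym; exact: il.
    by rewrite IHm ?mulr0 // (leq_trans ji) // addnS -addSn leq_add2r.
  have Nn : N ^+ n = 0.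
    apply/matrixP => i j; rewrite Npow ?mxE //.
    by rewrite (leq_trans (ltn_ord j)) ?leq_addl.
  exists (\sum_(i < n) N ^+ i).
  have := subrX1 N n; rewrite Nn sub0r.
  have -> : N - 1 = - T by rewrite /N addrAC subrr add0r.
  by rewrite mulNr => /oppr_inj/esym.
move=> uY; have [Y' YY'] := right_inv _ uY.
have [Y'' Y'Y''] := right_inv _ (unitriangularV uY YY').
exists Y' => //; suff -> : Y = Y'' by [].
by rewrite -[Y'']mul1mx -YY' -mulmxA Y'Y'' mulmx1.
Qed.

(** * The modules V_{i,lambda} *)

(** The orbit of [v_i]: the possible [i]-th columns of a lower unitriangular
    matrix. *)
Definition lowunit (i : 'I_n) b : bool :=
  [forall k : 'I_n, (k < i)%N ==> (b k 0 == 0)] && (b i 0 == 1).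

Lemma lowunitP (i : 'I_n) b :
  reflect ((forall k : 'I_n, (k < i)%N -> b k 0 = 0) /\ b i 0 = 1) (lowunit i b).
Proof.
apply: (iffP andP) => [[/forallP b0 /eqP b1]|[b0 b1]].
  by split=> // k ki; apply/eqP; exact: implyP (b0 k) ki.
split; last exact/eqP.
by apply/forallP => k; apply/implyP => /b0 ->.
Qed.

Lemma lowunit_delta i : lowunit i (delta_mx i 0).
Proof.
apply/lowunitP; rewrite mxE !eqxx; split=> // k ki.
by rewrite mxE -val_eqE ltn_eqF.
Qed.

Lemma Csub_dsub (c : GLmx A (n + n)) (x : 'cV_(n + n)) :
  c \in @Csub A star n -> dsubmx (c *m x) = dsubmx x.
Proof.
move=> Cc; have /dsub_Mspan := Csub_Mspan x Cc.
by rewrite linearB /= => /eqP; rewrite subr_eq0 => /eqP.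
Qed.

Lemma Lsub_Nvec (l : GLmx A (n + n)) : l \in @Lsub A star n ->
  exists2 Y' : 'M_n, unitriangular Y' &
    forall b, l *m Nvec b = Nvec (mxstar star Y' *m b).
Proof.
move=> /LsubP[_ [Y [Y' [uY YY' _ ->]]]].
exists Y' => [|b]; first exact: unitriangularV uY YY'.
by rewrite mul_block_col !mulmx0 !mul0mx !add0r.
Qed.

Lemma lowunit_nact i g b : lowunit i b -> lowunit i (nact g b).
Proof.
have [c [l [Cc Ll gE]]] := PgroupP g.
have [Y' [/trig_trP Y't Y'd] lN] := Lsub_Nvec Ll.
have -> : nact g b = mxstar star Y' *m b.
  by rewrite /nact gE glmxM -mulmxA Csub_dsub // lN dsub_Nvec.
move=> /lowunitP[b0 b1]; apply/lowunitP; split=> [k ki|].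
  rewrite mxE big1 // => j _; rewrite mxE; have [ji|ij] := ltnP j i.
    by rewrite b0 ?mulr0.
  by rewrite Y't ?star0 ?mul0r // (leq_trans ki).
rewrite mxE (bigD1 i) //= mxE Y'd star1 b1 mulr1 big1 ?addr0 // => j ji.
have [lji|] := ltnP j i; first by rewrite b0 ?mulr0.
rewrite leq_eqVlt => /orP[/eqP/val_inj ij|ij]; first by rewrite ij eqxx in ji.
by rewrite mxE Y't ?star0 ?mul0r.
Qed.

(** The [y i] are the columns of a lower unitriangular matrix [Z], and [L]
    contains the element acting by [Z] on [N] and by the inverse of [Z^*] on
    [M]. *)
Lemma nact_columns (y : 'I_n -> 'cV[A]_n) : (forall i, lowunit i (y i)) ->
  exists g : P, forall i, nact g (delta_mx i 0) = y i.
Proof.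
move=> yP; pose Z : 'M[A]_n := \matrix_(k, i) y i k 0.
have uZ : unitriangular (mxstar star Z).
  split=> [|i]; last by rewrite !mxE; have /lowunitP[_ ->] := yP i; exact: star1.
  apply/trig_trP => i j ji; rewrite !mxE.
  by have /lowunitP[y0 _] := yP i; rewrite y0 // star0.
have [Y' ZY' Y'Z] := unitriangular_inv uZ.
have uY' := unitriangularV uZ ZY'.
pose l0 : 'M_(n + n) := block_mx Y' 0 0 Z.
pose l1 : 'M_(n + n) := block_mx (mxstar star Z) 0 0 (mxstar star Y').
have ll1 : l0 *m l1 = 1%:M.
  rewrite mulmx_block !mul0mx !mulmx0 !addr0 !add0r Y'Z.
  by rewrite -[Z in Z *m _](mxstarK Z) -mxstarM Y'Z mxstar1 -scalar_mx_block.
have l1l : l1 *m l0 = 1%:M.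
  rewrite mulmx_block !mul0mx !mulmx0 !addr0 !add0r ZY'.
  by rewrite -[Z in _ *m Z](mxstarK Z) -mxstarM ZY' mxstar1 -scalar_mx_block.
pose l : GLmx A (n + n) := GLMx ll1 l1l.
have Ll : l \in @Lsub A star n.
  apply/LsubP; split; last by exists Y', (mxstar star Z); rewrite mxstarK.
  apply/asboolP => x x'; rewrite -[x]vsubmxK -[x']vsubmxK.
  rewrite !mul_block_col !mul0mx !addr0 !add0r !hformE; congr (fun M : 'M_1 => M 0 0).
  have ZsY : mxstar star Y' *m Z = 1%:M.
    by rewrite -[Z](mxstarK Z) -mxstarM ZY' mxstar1.
  have YsZ : mxstar star Z *m Y' = 1%:M by [].
  rewrite !mxstarM -!mulmxA (mulmxA _ Z) ZsY mul1mx.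
  by rewrite (mulmxA _ Y') YsZ mul1mx.
have Pl : l \in @Psub A star n.
  by apply/asboolP; exists 1%g, l; rewrite mul1g Csub1.
exists (SubgroupElt Pl) => i.
rewrite /nact mul_block_col !mulmx0 !mul0mx !add0r col_mxKd -colE.
by apply/matrixP => k j; rewrite !mxE ord1.
Qed.

(** [C] acts trivially modulo [M], so the stabilizer of [b] in [C L] is [C]
    times the stabilizer of [b] in [L]. *)
Lemma CLstabPE g b : (g \in CLstabP star (Nvec b)) = (nact g b == b).
Proof.
rewrite inE; apply/asboolP/eqP => [[c [l [Cc /LstabP[Ll lb] gE]]]|gb].
  by rewrite /nact gE glmxM -mulmxA lb Csub_dsub // dsub_Nvec.
have [c [l [Cc Ll gE]]] := PgroupP g; exists c, l; split=> //.
apply/LstabP; split=> //; have [Y' _ lN] := Lsub_Nvec Ll.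
by rewrite lN -[in RHS]gb /nact gE glmxM -mulmxA Csub_dsub // lN dsub_Nvec.
Qed.

Section ColumnAction.
Context (F : fieldType) (lam : linchar A F) (i : 'I_n).

Definition lowcol := {b : 'cV[A]_n | lowunit i b}.

Definition col_act g (x : lowcol) : lowcol :=
  exist _ (nact g (val x)) (lowunit_nact g (valP x)).

Definition col_coef g (x : lowcol) : F := lam (hcoef g (val x)).

Lemma col_act1 x : col_act 1%g x = x.
Proof. by apply: val_inj; exact: nact1. Qed.
Lemma col_actM g k x : col_act (g * k)%g x = col_act g (col_act k x).
Proof. by apply: val_inj; exact: nactM. Qed.
Lemma col_coef1 x : col_coef 1%g x = 1.
Proof. by rewrite /col_coef hcoef1 lchar0. Qed.
Lemma col_coefM g k x :
  col_coef (g * k)%g x = col_coef g (col_act k x) * col_coef k x.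
Proof. by rewrite /col_coef hcoefM lcharD. Qed.

Definition col_monomial : monomial_action P F lowcol :=
  MonomialAction col_act1 col_actM col_coef1 col_coefM.

Definition lowcol_base : lowcol := exist _ (delta_mx i 0) (lowunit_delta i).

Lemma col_transitive : transitive_from col_monomial lowcol_base.
Proof.
move=> x; pose y j := if j == i then val x else delta_mx j 0.
have yP j : lowunit j (y j).
  by rewrite /y; case: eqP => [->|_]; [exact: valP|exact: lowunit_delta].
have [g gy] := nact_columns yP; exists g; apply/eqP/val_inj.
by rewrite /= gy /y eqxx.
Qed.

Lemma Vmod_monomial :
  exists b : lowcol -> Vmod star lam i, monomial_basis col_monomial b.
Proof.
have stab g : (g \in CLstabP star (Nvec (delta_mx i 0))) =
    (mact col_monomial g lowcol_base == lowcol_base).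
  exact: CLstabPE.
have chiE (k : subgroup_type (CLstabP star (Nvec (delta_mx i 0)))) :
    chi lam k = mcoef col_monomial (sgval k) lowcol_base.
  rewrite /chi /= /col_coef /hcoef /=; congr (lam (h _ (Nvec _))).
  by apply/esym/eqP; rewrite -CLstabPE; exact: sgvalP.
exact: ex_intro (ind_basis_monomial (chi1 star _ lam) (chiM lam) col_transitive stab chiE).
Qed.

End ColumnAction.

End UnitaryAction.

(** * Characters of C *)

Section Characters.
Context (A : nzRingType) (star : involution A) (F : fieldType).
Implicit Types lam : linchar A F.

(** The multiples [a * (u - w)] form a left ideal in the kernel of the
    character [a |-> lam (a^* + a)]. *)
Lemma admissible_inj lam u w : left_admissible star lam ->
  (forall a, lam (a * u + star (a * u)) = lam (a * w + star (a * w))) -> u = w.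
Proof.
move=> adm uw; pose I : set A := [set c | exists a, c = a * (u - w)]%classic.
have I0 : I = [set 0]%classic.
  apply: adm => [|_ [a ->]].
    split=> [|_ _ [a ->] [b ->]|c _ [a ->]].
    - by exists 0; rewrite mul0r.
    - by exists (a + b); rewrite mulrDl.
    - by exists (c * a); rewrite mulrA.
  apply: (mulIf (lchar_neq0 lam (a * w + star (a * w)))).
  by rewrite -lcharD addrACA -involD -mulrDr subrK mul1r.
have : I (u - w) by exists 1; rewrite mul1r.
by rewrite I0 => /= /eqP; rewrite subr_eq0 => /eqP.
Qed.

(** Otherwise [A] itself would be a left ideal in that kernel. *)
Lemma admissible_nontrivial lam : left_admissible star lam ->
  ~ (forall r, star r = r -> lam r = 1).
Proof.
move=> adm lam1; have /eqP := oner_neq0 A; apply; apply: (admissible_inj adm) => a.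
by rewrite !lam1 // ?mulr0 ?star0 ?addr0 ?star0 // involD involK addrC.
Qed.

Context (n : nat).
Implicit Types (x : 'cV[A]_n) (S : 'M[A]_n).
Local Notation herm := (@herm A star n).

Lemma hermD x S T : herm x (S + T) = herm x S + herm x T.
Proof. by rewrite /herm mulmxDr mulmxDl mxE. Qed.

Lemma star_herm x S : mxstar star S = S -> star (herm x S) = herm x S.
Proof. by move=> SS; rewrite -mxstarE !mxstarM mxstarK SS mulmxA. Qed.

Lemma herm_delta x a i j :
  herm x (a *: delta_mx i j) = star (x i 0) * a * x j 0.
Proof.
rewrite /herm mxE (bigD1 j) //= [X in X * _]mxE (bigD1 i) //= !mxE !eqxx mulr1.
rewrite big1 => [|k ki]; last by rewrite !mxE (negPf ki) !mulr0.
rewrite addr0 big1 ?addr0 // => k kj; rewrite mxE big1 ?mul0r // => l _.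
by rewrite !mxE (negPf kj) andbF !mulr0.
Qed.

Lemma mxstar_delta a i j :
  mxstar star (a *: delta_mx i j : 'M[A]_n) = star a *: delta_mx j i.
Proof.
apply/matrixP => k l; rewrite !mxE andbC.
by case: (_ && _); rewrite ?mulr1 // !mulr0 star0.
Qed.

Definition sym_mx a i j : 'M[A]_n := a *: delta_mx i j + star a *: delta_mx j i.

Lemma sym_mx_herm a i j : mxstar star (sym_mx a i j) = sym_mx a i j.
Proof. by rewrite mxstarD !mxstar_delta involK addrC. Qed.

Lemma herm_sym_mx x a i j : herm x (sym_mx a i j) =
  star (x i 0) * a * x j 0 + star (star (x i 0) * a * x j 0).
Proof. by rewrite hermD !herm_delta !involM involK mulrA. Qed.

(** Strong induction on [i].  A matrix [S] with [y^* S y = 0] for all columns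
    [y] of index beyond [i] isolates the factor at [i]; this applies to
    [r E_ii] and to [a E_ij + a^* E_ji] with [j > i]. *)
Lemma tuple_character_inj (D D' : {set 'I_n}) (lam lam' : 'I_n -> linchar A F)
    (x x' : 'I_n -> 'cV[A]_n) :
  (forall i, i \in D -> left_admissible star (lam i) /\ lowunit i (x i)) ->
  (forall i, i \in D' -> left_admissible star (lam' i) /\ lowunit i (x' i)) ->
  (forall S, mxstar star S = S ->
     \prod_(i in D) lam i (herm (x i) S) =
     \prod_(i in D') lam' i (herm (x' i) S)) ->
  D = D' /\ forall i, i \in D ->
    x i = x' i /\ forall r, star r = r -> lam i r = lam' i r.
Proof.
move=> Dadm D'adm eqP.
pose same (i : 'I_n) := (i \in D) = (i \in D') /\ (i \in D ->
  x i = x' i /\ forall r, star r = r -> lam i r = lam' i r).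
suff all_same i : same i.
  by split=> [|i]; [apply/setP => i; case: (all_same i)|case: (all_same i)].
have [m] := ubnP (i : nat); elim: m i => // m IHm i; rewrite ltnS => im.
have {IHm}IH (k : 'I_n) : (k < i)%N -> same k.
  by move=> ki; apply: IHm; exact: leq_trans ki im.
pose f k S := if k \in D then lam k (herm (x k) S) else 1.
pose f' k S := if k \in D' then lam' k (herm (x' k) S) else 1.
have fi S : mxstar star S = S ->
    (forall (k : 'I_n) y, (i < k)%N -> lowunit k y -> herm y S = 0) -> f i S = f' i S.
  move=> SS S0; have := eqP S SS; rewrite [LHS]big_mkcond [RHS]big_mkcond.
  rewrite -/(f _ S) [LHS](bigD1 i) // [RHS](bigD1 i) //= -/(f i S) -/(f' i S).
  rewrite [X in _ = _ * X](eq_bigr (f^~ S)) => [|k].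
    apply: mulIf; rewrite prodf_seq_neq0; apply/allP => k _; apply/implyP => _.
    by case: ifP => _; rewrite ?oner_neq0 ?lchar_neq0.
  rewrite /f neq_ltn => /orP[/IH[<-]|ik].
    case: ifP => // kD [] // <- eqk; rewrite eqk //.
    exact: star_herm.
  have eq1 (c : bool) (l : linchar A F) y : (c -> lowunit k y) ->
      (if c then l (herm y S) else 1) = 1.
    by case: c => // /(_ isT)/(S0 _ _ ik) ->; rewrite lchar0.
  by rewrite !eq1 // => [/Dadm[]|/D'adm[]].
(* The diagonal matrix [r E_ii], with value [r] on the columns of index [i]. *)
have frr r : star r = r ->
    (if i \in D then lam i r else 1) = (if i \in D' then lam' i r else 1).
  move=> rr; have fE (c : bool) (l : linchar A F) y : (c -> lowunit i y) ->
      (if c then l (herm y (r *: delta_mx i i)) else 1) = if c then l r else 1.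
    case: c => // /(_ isT)/lowunitP[_ y1].
    by rewrite herm_delta y1 star1 mul1r mulr1.
  rewrite -(fE _ _ (x i)) => [|/Dadm[] //]; rewrite -(fE _ _ (x' i)) => [|/D'adm[] //].
  apply: fi => [|k y ik /lowunitP[y0 _]]; first by rewrite mxstar_delta rr.
  by rewrite herm_delta y0 // mulr0.
have eqD : (i \in D) = (i \in D').
  have [iD|iD] := boolP (i \in D); have [iD'|iD'] := boolP (i \in D') => //.
    case: (admissible_nontrivial (Dadm i iD).1) => r rr.
    by have := frr r rr; rewrite iD (negPf iD').
  case: (admissible_nontrivial (D'adm i iD').1) => r rr.
  by have := frr r rr; rewrite iD' (negPf iD).
split=> // iD; have iD' : i \in D' by rewrite -eqD.
have lamr r : star r = r -> lam i r = lam' i r.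
  by move=> rr; have := frr r rr; rewrite iD iD'.
split=> //; have [adm /lowunitP[x0 x1]] := Dadm i iD.
have [_ /lowunitP[x'0 x'1]] := D'adm i iD'.
apply/matrixP => j z; rewrite (ord1 z).
have [ji|ij|/val_inj ->] := ltngtP j i; last by rewrite x1 x'1.
  by rewrite x0 ?x'0.
(* On the column [x i] the matrix has value [a x_j + (a x_j)^*]. *)
apply: (admissible_inj adm) => a; have := fi (sym_mx a i j) (sym_mx_herm _ _ _).
rewrite /f /f' iD iD' !herm_sym_mx x1 x'1 star1 mul1r => ->; last first.
  by move=> k y ik /lowunitP[y0 _]; rewrite herm_sym_mx y0 // star0 !mul0r star0 addr0.
by rewrite lamr // involD involK addrC.
Qed.

End Characters.

(** * The modules V(D,lambda) *)

Section Modules.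
Context (A : nzRingType) (star : involution A) (n : nat) (F : fieldType).
Local Notation P := (Pgroup star n).
Implicit Types (lam : linchar A F) (i : 'I_n) (D : {set 'I_n}).

Lemma Cgroup_fixing lam i S (SS : mxstar star S = S) :
  pointwise_fixing (col_monomial star lam i) (Cgroup SS).
Proof. by move=> x; apply: val_inj; exact: nact_Cgroup. Qed.

(** Separation is the case of the one-element set [[set i]] of
    [tuple_character_inj]. *)
Lemma Vmod_irreducible lam i :
  left_admissible star lam -> irreducible (Vmod star lam i).
Proof.
move=> adm; have [b bM] := Vmod_monomial star lam i.
apply: (monomial_irreducible bM (col_transitive star lam (i := i))) => x y xy.
apply: val_inj.
have [||S SS|_ /(_ i)] := @tuple_character_inj A star F n [set i] [set i]
    (fun=> lam) (fun=> lam) (fun=> val x) (fun=> val y).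
- by move=> j /set1P ->; split=> //; exact: valP.
- by move=> j /set1P ->; split=> //; exact: valP.
- rewrite !big_set1 -!(hcoef_Cgroup SS); apply: xy; exact: Cgroup_fixing.
by rewrite set11 => /(_ isT)[].
Qed.


Lemma tail_subproof i (j : 'I_(n - i.+1)) : (i.+1 + j < n)%N.
Proof. by rewrite -ltn_subRL. Qed.

Definition lowcol_tail i (x : lowcol A i) : 'rV[A]_(n - i.+1) :=
  \row_j val x (Ordinal (tail_subproof j)) 0.

Definition tail_col i (r : 'rV[A]_(n - i.+1)) : 'cV[A]_n :=
  \col_k if (k <= i)%N then (k == i)%:R else oapp (r 0) 0 (insub (k - i.+1)%N).

Lemma tail_col_lowunit i r : lowunit i (@tail_col i r).
Proof.
apply/lowunitP; rewrite mxE leqnn eqxx; split=> // k ki.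
by rewrite mxE ltnW // -val_eqE ltn_eqF.
Qed.

Definition tail_lowcol i r : lowcol A i := 
  exist _ (tail_col r) (tail_col_lowunit r).

Lemma tail_lowcolK i : cancel (@tail_lowcol i) (@lowcol_tail i).
Proof.
move=> r; apply/rowP => j; rewrite !mxE /=.
rewrite leqNgt ltn_addr ?ltnSn //= addKn insubT ?ltn_ord // => jn /=.
by congr (r 0 _); apply: val_inj.
Qed.

Lemma lowcol_tailK i : cancel (@lowcol_tail i) (@tail_lowcol i).
Proof.
move=> x; apply: val_inj; apply/colP => k; rewrite !mxE.
have /lowunitP[x0 x1] := valP x.
have [ki|ik] := leqP k i.
  have [->|kni] := eqVneq k i; first by rewrite x1.
  by rewrite x0 // ltn_neqAle ki andbT.
have kn : (k - i.+1 < n - i.+1)%N 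
  by rewrite ltn_sub2r // (leq_ltn_trans ik).
rewrite insubT /= mxE; congr (val x _ 0); apply: val_inj => /=.
by rewrite subnKC.
Qed.

Lemma Vmod_dim lam i : has_dim (Vmod star lam i) 'rV[A]_(n - i.+1).
Proof.
have [b [bB _]] := Vmod_monomial star lam i.
exists (b \o @tail_lowcol i); apply: (basis_reindex bB).
exact: Bijective (@tail_lowcolK i) (@lowcol_tailK i).
Qed.

Section Tuples.
Context (D : {set 'I_n}).
Implicit Types (lams : {i : 'I_n | i \in D} -> linchar A F).
Local Notation tuples := (forall u : {i : 'I_n | i \in D}, lowcol A (sval u)).

Definition tuple_monomial lams : monomial_action P F tuples :=
  prod_monomial (fun u => col_monomial star (lams u) (sval u)).

Definition tuple_base : tuples := fun u => lowcol_base A (sval u).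

Lemma VD_monomial lams :
  exists b : tuples -> VD star D lams, monomial_basis (tuple_monomial lams) b.
Proof.
pose e u := cid (Vmod_monomial star (lams u) (sval u)).
exact: ex_intro (tensor_basis_monomial (fun u => projT2 (e u))).
Qed.

Lemma tuple_transitive lams : transitive_from (tuple_monomial lams) tuple_base.
Proof.
move=> y; pose Y i : 'cV[A]_n := oapp (fun u => val (y u)) (delta_mx i 0) (insub i).
have YP i : lowunit i (Y i).
  rewrite /Y; case: insubP => [u _ <-|_]; first exact: valP (y u).
  exact: lowunit_delta.
have [g gY] := nact_columns star YP; exists g; apply/eqP.
apply: functional_extensionality_dep => u; apply: val_inj.
by rewrite /= gY /Y valK.
Qed.

Lemma Cgroup_tuple_fixing lams S (SS : mxstar star S = S) :
  pointwise_fixing (tuple_monomial lams) (Cgroup SS).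
Proof.
by move=> x; apply: functional_extensionality_dep => u; exact: Cgroup_fixing.
Qed.

Definition trivial_char : linchar A F :=
  @LinChar A F (fun=> 1) (fun=> oner_neq0 _) (fun _ _ => esym (mulr1 1)).

(** Families indexed by [D] are extended to all of ['I_n], so that two index
    sets can be compared. *)
Definition ext_char lams i : linchar A F := oapp lams trivial_char (insub i).

Definition ext_col (x : tuples) i : 'cV[A]_n :=
  oapp (fun u => val (x u)) 0 (insub i).

Lemma tuple_mcoef_Cgroup lams x S (SS : mxstar star S = S) :
  mcoef (tuple_monomial lams) (Cgroup SS) x =
  \prod_(i in D) ext_char lams i (herm star (ext_col x i) S).
Proof.
rewrite big_sub; apply: eq_bigr => u _.
by rewrite /ext_char /ext_col valK /= /col_coef hcoef_Cgroup.
Qed.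

Lemma ext_admissible lams x : (forall u, left_admissible star (lams u)) ->
  forall i, i \in D ->
    left_admissible star (ext_char lams i) /\ lowunit i (ext_col x i).
Proof.
move=> adm i iD; rewrite /ext_char /ext_col insubT /=; split; first exact: adm.
exact: valP (x (exist _ i iD)).
Qed.

End Tuples.

Lemma VD_irreducible D (lams : {i : 'I_n | i \in D} -> linchar A F) :
  (forall u, left_admissible star (lams u)) -> irreducible (VD star D lams).
Proof.
move=> adm; have [b bM] := VD_monomial lams.
apply: (monomial_irreducible bM (tuple_transitive lams)) => x y xy.
have [S SS|_ eqxy] := tuple_character_inj (ext_admissible x adm) (ext_admissible y adm).
  by rewrite -!tuple_mcoef_Cgroup; apply: xy; exact: Cgroup_tuple_fixing.
apply: functional_extensionality_dep => u; apply: val_inj.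
by have [] := eqxy _ (valP u); rewrite /ext_col valK.
Qed.

Lemma VD_is_monomial D (lams : {i : 'I_n | i \in D} -> linchar A F) :
  monomial (VD star D lams).
Proof.
have [b bM] := VD_monomial lams.
exact: transitive_monomial bM (tuple_transitive lams).
Qed.

Lemma VD_iso D D' (lams : {i : 'I_n | i \in D} -> linchar A F)
    (lams' : {i : 'I_n | i \in D'} -> linchar A F) :
  (forall u, left_admissible star (lams u)) ->
  (forall u, left_admissible star (lams' u)) ->
  gmodule_iso (VD star D lams) (VD star D' lams') <->
  D = D' /\
  (forall i (Di : i \in D) (D'i : i \in D') r,
     star r = r -> lams (exist _ i Di) r = lams' (exist _ i D'i) r).
Proof.
move=> adm adm'; have [b bM] := VD_monomial lams.
have [b' bM'] := VD_monomial lams'; split=> [[f [fl /bij_inj fI fG]]|[eqD]].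
  have [x' xx'] := hom_coef (@tuple_base D) bM bM' fl fI fG.
  have [S SS|eqD eqx] := tuple_character_inj (ext_admissible (@tuple_base D) adm)
      (ext_admissible x' adm').
    by rewrite -!tuple_mcoef_Cgroup; apply: xx'; exact: Cgroup_tuple_fixing.
  split=> // i Di D'i r rr; have [_ /(_ r rr)] := eqx i Di.
  by rewrite /ext_char !insubT.
case: D' / eqD lams' adm' b' bM' => lams' _ b' bM' eql.
apply: (monomial_basis_iso bM bM') => // g x; apply: eq_bigr => -[i Di] _.
by apply: eql; exact: star_hcoef.
Qed.

End Modules.

Theorem theorem1p1 (A : nzRingType) (star : involution A) (n : nat)
    (n_gt0 : (0 < n)%N) (F : fieldType) :
  [/\ (forall (lam : linchar A F) (i : 'I_n), left_admissible star lam ->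
        irreducible (Vmod star lam i) /\
        has_dim (Vmod star lam i) 'rV[A]_(n - i.+1)),
      (forall (D : {set 'I_n}) (lam : {i : 'I_n | i \in D} -> linchar A F),
        D != set0 -> (forall i, left_admissible star (lam i)) ->
        monomial (VD star D lam) /\ irreducible (VD star D lam))
    & (forall (D D' : {set 'I_n})
         (lam : {i : 'I_n | i \in D} -> linchar A F)
         (lam' : {i : 'I_n | i \in D'} -> linchar A F),
        D != set0 -> (forall i, left_admissible star (lam i)) ->
        D' != set0 -> (forall i, left_admissible star (lam' i)) ->
        gmodule_iso (VD star D lam) (VD star D' lam') <->
        D = D' /\
        (forall (i : 'I_n) (Di : i \in D) (D'i : i \in D') (r : A),
          star r = r -> lam (exist _ i Di) r = lam' (exist _ i D'i) r))].
Proof.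
split=> [lam i adm|D lam _ adm|D D' lam lam' _ adm _ adm'].
- by split; [exact: Vmod_irreducible|exact: Vmod_dim].
- by split; [exact: VD_is_monomial|exact: VD_irreducible].
- exact: VD_iso.
Qed.
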